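(* Let $L\subseteq a^*$ be a language over the one-letter alphabet $\{a\}$ satisfying the following two conditions: 1. $\underline{dens}(L) = 0$. 2. For every positive integer $Q$ there exist $h\in\mathbb{N}$ and an infinite sequence $(n_i)_{i\in\mathbb{N}}$ of natural numbers such that $a^{h+n_iQ}\in L$ for all $i$, and for every irrational number $\alpha$ the sequence $\left((h+n_iQ)\alpha\right)_{i\in\mathbb{N}}$ is uniformly distributed mod $1$. Then $L\notin\mathsf{BAfL}$, i.e. $L$ is not recognized with bounded error by any affine finite automaton.
   Context: The lower density of $L\subseteq a^*$ is $$\underline{dens}(L) = \liminf_{n\to\infty}\frac{\left|\{a^k\in L : k\le n\}\right|}{n+1}.$$ A sequence $(x_i)$ of real numbers is uniformly distributed mod $1$ if for all $0\le a<b\le 1$ the number $C([a,b),n)$ of indices $1\le i\le n$ with $x_i \bmod 1\in[a,b)$ satisfies $\lim_{n\to\infty} C([a,b),n)/n = b-a$. A real vector is affine if its coordinates sum to $1$; a real square matrix is affine if each of its columns is an affine vector. An affine finite automaton (AfA) over a finite alphabet $\Sigma$ is a tuple $A = (E, \Sigma, \{M_x\}_{x\in\Sigma}, \vec{v}_0, E_a)$, where $E=\{e_1,\dots,e_k\}$ is a finite set of states, each $M_x$ is a $k\times k$ real affine matrix, $\vec{v}_0\in\mathbb{R}^k$ is an affine vector (the initial state), and $E_a\subseteq E$ is the set of accepting states. For $w = w_1\cdots w_n\in\Sigma^*$ put $M_w = M_{w_n}\cdots M_{w_1}$ (the identity if $w$ is the empty word) and $\vec{v}_f = M_w\vec{v}_0$.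 The function $f_A:\Sigma^*\to[0,1]$ computed by $A$ is $$f_A(w) = \frac{\sum_{e_i\in E_a} |(\vec{v}_f)_i|}{\sum_{e_i\in E} |(\vec{v}_f)_i|}.$$ A language $L\subseteq\Sigma^*$ is recognized by $A$ with bounded error if there exists $\varepsilon$ with $0<\varepsilon<\frac12$ such that $f_A(w)\ge 1-\varepsilon$ for all $w\in L$ and $f_A(w)\le\varepsilon$ for all $w\in\Sigma^*\setminus L$. $\mathsf{BAfL}$ denotes the class of languages recognized with bounded error by some AfA. *)

(* Defs.v *)
From mathcomp Require Import all_boot all_order all_algebra.
From mathcomp Require Import all_classical all_reals all_analysis.

Set Implicit Arguments.
Unset Strict Implicit.
Unset Printing Implicit Defensive.

Import Order.TTheory GRing.Theory Num.Theory.
Import numFieldNormedType.Exports.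

Local Open Scope classical_set_scope.
Local Open Scope ring_scope.

Definition language (Sigma : finType) := set (seq Sigma).

(* The one-letter alphabet {a} is [unit]. *)
Definition apow (k : nat) : seq unit := nseq k tt.

Definition lower_dens (R : realType) (L : language unit) : \bar R :=
  limn_einf (fun n : nat =>
    ((#|[pred k : 'I_n.+1 | apow k \in L]|)%:R / n.+1%:R : R)%:E).

Definition mod1 (R : realType) (x : R) : R := x - (Num.floor x)%:~R.

(* Sequences are indexed from 0: [i < n] ranges over the first [n] terms. *)
Definition unif_count (R : realType) (x : nat -> R) (a b : R) (n : nat) : nat :=
  #|[pred i : 'I_n | a <= mod1 (x i) < b]|.

Definition unif_distr_mod1 (R : realType) (x : nat -> R) : Prop :=
  forall a b : R, 0 <= a -> a < b -> b <= 1 ->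
    (unif_count x a b n)%:R / n%:R @[n --> \oo] --> b - a.

Definition affine_vec (R : realType) (k : nat) (v : 'cV[R]_k) : Prop :=
  \sum_(i < k) v i 0 = 1.

Definition affine_mx (R : realType) (k : nat) (M : 'M[R]_k) : Prop :=
  forall j : 'I_k, affine_vec (col j M).

Record AfA (R : realType) (Sigma : finType) := MkAfA {
  afa_size : nat;
  afa_mx : Sigma -> 'M[R]_afa_size;
  afa_init : 'cV[R]_afa_size;
  afa_acc : {set 'I_afa_size};
  afa_mx_affine : forall x, affine_mx (afa_mx x);
  afa_init_affine : affine_vec afa_init
}.

(* M_w = M_{w_n} ... M_{w_1}: later letters multiply on the left. *)
Definition afa_word_mx (R : realType) (Sigma : finType) (A : AfA R Sigma)
    (w : seq Sigma) : 'M[R]_(afa_size A) :=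
  foldl (fun M x => afa_mx A x *m M) 1%:M w.

Definition afa_final (R : realType) (Sigma : finType) (A : AfA R Sigma)
    (w : seq Sigma) : 'cV[R]_(afa_size A) :=
  afa_word_mx A w *m afa_init A.

(* The denominator is positive, since the entries of the final vector sum
   to 1. *)
Definition afa_fun (R : realType) (Sigma : finType) (A : AfA R Sigma)
    (w : seq Sigma) : R :=
  (\sum_(i in afa_acc A) `|afa_final A w i 0|) /
  (\sum_i `|afa_final A w i 0|).

Definition recognizes_bounded_error (R : realType) (Sigma : finType)
    (A : AfA R Sigma) (L : language Sigma) : Prop :=
  exists eps : R, [/\ 0 < eps, eps < 1 / 2,
    forall w, L w -> 1 - eps <= afa_fun A w &
    forall w, ~ L w -> afa_fun A w <= eps].

Definition BAfL (R : realType) (Sigma : finType) : set (language Sigma) :=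
  [set L | exists A : AfA R Sigma, recognizes_bounded_error A L].

(* Main.v *)
(** Iterating the automaton, each coordinate of the state after [n] letters is a
    sum of terms [c mu^n C(n, d)] with [mu] an eigenvalue.  Choose [Q] killing the
    torsion, modulo 1, of the group generated by the eigenvalue arguments.  On a
    class [n = h mod Q], after division by the dominant growth [r^n C(n, d)] the
    coordinates become trigonometric polynomials [y_i(n) + o(1)], not all zero on
    the class, with every frequency either irrational or constant on the class.
    By Weyl's criterion such a polynomial has the same mean along any equidistributed
    sampling of the class, and by uniform approximation of [|x|] so does
    [W = sum_(i in acc) |y_i| - 1/2 sum_i |y_i|] up to any [d > 0].  Along
    [h + n_i Q] we stay in [L], so the mean of [W] is nonnegative; along the full
    class [h + m Q] we are outside [L] at density 1 on a subsequence, where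
    [W <= - (1/2 - eps) sum_i |y_i|], and [sum_i |y_i|] dominates a multiple of
    [sum_i y_i^2], whose mean is positive: a contradiction. *)
Require Import Defs.
From mathcomp Require Import all_boot all_order all_algebra.
From mathcomp Require Import all_classical all_reals all_analysis.
From mathcomp Require Import complex ring lra.

Set Implicit Arguments.
Unset Strict Implicit.
Unset Printing Implicit Defensive.

Import Order.TTheory GRing.Theory Num.Theory.
Import numFieldNormedType.Exports.

Local Open Scope classical_set_scope.
Local Open Scope complex_scope.
Local Open Scope ring_scope.

(** * The complex exponential of period 1 and polar form *)

Section ComplexExponential.
Context {R : realType}.
Implicit Types (x y : R) (z w : R[i]).

Definition expi x : R[i] := cos (pi *+ 2 * x) +i* sin (pi *+ 2 * x).

Lemma cReM z w :
  complex.Re (z * w) = complex.Re z * complex.Re w - complex.Im z * complex.Im w.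
Proof. by case: z w => [a b] [c d]. Qed.

Lemma cImM z w :
  complex.Im (z * w) = complex.Re z * complex.Im w + complex.Im z * complex.Re w.
Proof. by case: z w => [a b] [c d]. Qed.

Lemma cReD z w : complex.Re (z + w) = complex.Re z + complex.Re w.
Proof. by case: z w => [a b] [c d]. Qed.

Lemma cImD z w : complex.Im (z + w) = complex.Im z + complex.Im w.
Proof. by case: z w => [a b] [c d]. Qed.

Lemma cRe_sum I (r : seq I) (P : pred I) (F : I -> R[i]) :
  complex.Re (\sum_(i <- r | P i) F i) = \sum_(i <- r | P i) complex.Re (F i).
Proof. by apply: (big_morph _ cReD). Qed.

Lemma cIm_sum I (r : seq I) (P : pred I) (F : I -> R[i]) :
  complex.Im (\sum_(i <- r | P i) F i) = \sum_(i <- r | P i) complex.Im (F i).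
Proof. by apply: (big_morph _ cImD). Qed.

Lemma expi0 : expi 0 = 1.
Proof. by rewrite /expi mulr0 cos0 sin0. Qed.

Lemma expiD x y : expi (x + y) = expi x * expi y.
Proof.
apply/eqP; rewrite eq_complex cReM cImM /= mulrDr cosD sinD eqxx /=.
by apply/eqP; rewrite addrC.
Qed.

Lemma conjc_expi x : conjc (expi x) = expi (- x).
Proof. by rewrite /expi /= mulrN cosN sinN. Qed.

Lemma expi1 : expi 1 = 1.
Proof. by rewrite /expi mulr1 cos2pi sin2pi. Qed.

Lemma expiMn x n : expi (x * n%:R) = expi x ^+ n.
Proof.
elim: n => [|n IH]; first by rewrite mulr0 expi0 expr0.
by rewrite -natr1 mulrDr mulr1 expiD IH exprSr.
Qed.

Lemma expi_int (k : int) : expi k%:~R = 1.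
Proof.
have expi_nat n : expi n%:R = 1 by rewrite -[n%:R]mul1r expiMn expi1 expr1n.
case: k => n; first by rewrite -pmulrn expi_nat.
by rewrite NegzE mulrNz -conjc_expi -pmulrn expi_nat conjc1.
Qed.

(** Modulo the integer part, [cos (2 pi f) = 1 - 2 sin^2 (pi f)] equals 1 only at [f = 0], as [sin]
    is positive on (0, pi). *)
Lemma expi_eq1 x : expi x = 1 -> exists k : int, x = k%:~R.
Proof.
have pi0 := @pi_gt0 R.
move=> ex1; exists (Num.floor x).
have /andP[f0 f1] : 0 <= x - (Num.floor x)%:~R < 1.
  by have /andP[] := floor_itv x; rewrite intrD => ? ?; lra.
set f := x - _ in f0 f1 *.
have : expi f = 1 by rewrite expiD ex1 mul1r -mulrNz expi_int.
move=> [+ _].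
rewrite mulrnAl cos_mulr2n cos2sin2 => /eqP.
have [f0' | f0'] := eqVneq f 0; first by move=> _; apply/eqP; rewrite -subr_eq0 -/f f0'.
have f_gt0 : 0 < f by rewrite lt_neqAle eq_sym f0' f0.
have /sin_gt0_pi s0 : 0 < pi * f < pi.
  by apply/andP; split; [exact: mulr_gt0 | rewrite gtr_pMr].
have : 0 < sin (pi * f) ^+ 2 by rewrite exprn_gt0.
move=> ? /eqP ?; lra.
Qed.

Lemma mul_expiJ x : expi x * conjc (expi x) = 1.
Proof. by rewrite conjc_expi -expiD subrr expi0. Qed.

Definition cabs z : R := Num.sqrt (complex.Re z ^+ 2 + complex.Im z ^+ 2).

Lemma cabs_gt0 z : z != 0 -> 0 < cabs z.
Proof.
case: z => a b; rewrite eq_complex negb_and /= sqrtr_gt0 /=.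
by case/orP => ?; [apply: ltr_pwDl | apply: ltr_wpDl]; rewrite ?sqr_ge0 ?exprn_even_gt0.
Qed.

(** The angle is [acos] of the normalised real part [a] up to sign: [sin (acos a)] only recovers
    [|b|], so the sign of [b] decides that of the angle. *)
Lemma polarP z : z != 0 -> exists x, z = (cabs z)%:C * expi x.
Proof.
move=> z0; set r := cabs z; have r0 : 0 < r := cabs_gt0 z0.
have rE : r ^+ 2 = complex.Re z ^+ 2 + complex.Im z ^+ 2.
  by rewrite sqr_sqrtr// addr_ge0 ?sqr_ge0.
set a := complex.Re z / r; set b := complex.Im z / r.
have ab : a ^+ 2 + b ^+ 2 = 1.
  rewrite /a /b !expr_div_n -mulrDl -rE divff//.
  by rewrite expf_neq0// gt_eqF.
have aI : -1 <= a <= 1.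
  rewrite -ler_norml -(@expr_le1 _ 2)// real_normK ?num_real//.
  by rewrite -ab lerDl sqr_ge0.
have [acI cosa] := acos_def aI.
have sina := sin_acos aI.
have sb : Num.sqrt (1 - a ^+ 2) = `|b|.
  by rewrite -[in LHS]ab addrAC subrr add0r sqrtr_sqr.
have pi0 := @pi_gt0 R.
have pik t : pi *+ 2 * (t / (pi *+ 2)) = t :> R.
  by rewrite mulrC divfK// gt_eqF// mulrn_wgt0.
have rebuild : z = r%:C * (a +i* b).
  apply/eqP; rewrite eq_complex cReM cImM /= !mul0r subr0 addr0.
  by rewrite /a /b !mulrA ![r * _]mulrC !mulfK ?(lt0r_neq0 r0)// !eqxx.
have [b0 | b0] := leP 0 b.
  exists (acos a / (pi *+ 2)); rewrite {1}rebuild /expi pik cosa sina sb.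
  by rewrite ger0_norm.
exists (- acos a / (pi *+ 2)); rewrite {1}rebuild /expi pik cosN sinN cosa sina sb.
by rewrite ltr0_norm// opprK.
Qed.

Lemma cos_lipschitz x y : `|cos x - cos y| <= `|x - y|.
Proof.
wlog xy : x y / y <= x => [hw|].
  by case/orP: (le_total y x) => /hw//; rewrite distrC [`|y - x|]distrC.
have [c _ ->] : exists2 c, c \in `[y, x] & cos x - cos y = - sin c * (x - y).
  apply: (@MVT_segment _ cos (fun c => - sin c)) => //.
  exact/continuous_subspaceT/continuous_cos.
by rewrite normrM normrN ler_piMl// sin_max.
Qed.

End ComplexExponential.

Arguments expi : simpl never.

(** * Cesaro means of real and complex sequences *)

Section Means.
Context {R : realType}.
Implicit Types (a b : nat -> R) (f g : nat -> R[i]).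

Definition avg a (N : nat) : R := (\sum_(i < N) a i) / N%:R.

Definition is_mean a (l : R) : Prop := avg a N @[N --> \oo] --> l.

Lemma is_meanD a b l m :
  is_mean a l -> is_mean b m -> is_mean (fun n => a n + b n) (l + m).
Proof.
move=> al bm; rewrite /is_mean.
rewrite (_ : avg _ = (fun N => avg a N + avg b N)); first exact: cvgD.
by apply/funext => N; rewrite /avg big_split mulrDl.
Qed.

Lemma is_meanZ c a l : is_mean a l -> is_mean (fun n => c * a n) (c * l).
Proof.
move=> al; rewrite /is_mean.
rewrite (_ : avg _ = (fun N => c * avg a N)); first exact: cvgMl_tmp.
by apply/funext => N; rewrite /avg -mulr_sumr mulrA.
Qed.

Lemma is_meanB a b l m :
  is_mean a l -> is_mean b m -> is_mean (fun n => a n - b n) (l - m).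
Proof.
move=> al bm; have := is_meanD al (is_meanZ (c := -1) bm).
by rewrite mulN1r; congr is_mean; apply/funext => n; rewrite mulN1r.
Qed.

Lemma is_mean_cst c : is_mean (fun=> c) c.
Proof.
apply: cvg_near_cst.
exists 1%N => // N /= N0; rewrite /avg /= sumr_const card_ord -[c *+ N]mulr_natr mulfK//.
by rewrite pnatr_eq0 -lt0n.
Qed.

Lemma eq_is_mean a b l : a =1 b -> is_mean a l -> is_mean b l.
Proof. by move/funext->. Qed.

Lemma is_mean_ge0 a l : (forall n, 0 <= a n) -> is_mean a l -> 0 <= l.
Proof.
move=> a0 al; apply: (cvgr_to_ge al).
by apply: nearW => N; rewrite /avg mulr_ge0 ?invr_ge0 ?sumr_ge0.
Qed.

(* The exceptional indices need only be rare along a subsequence of [N], which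
   is all that a zero lower density provides. *)
Lemma is_mean_le a (l b B : R) :
  (forall n, a n <= B) -> is_mean a l ->
  (forall (k : R) (N0 : nat), 0 < k -> exists2 N, (N0 <= N)%N &
     (\sum_(i < N) (b < a i)%R)%:R <= k * N%:R :> R) ->
  l <= b.
Proof.
move=> aB al freq; rewrite leNgt; apply/negP => bl.
pose d := (l - b) / 2; have d0 : 0 < d by rewrite /d; lra.
have [N0 _ near_l] : \forall N \near \oo, `|l - avg a N| < d.
  by move/cvgrPdist_lt : al; exact.
(* [C] dominates [B - b], so a proportion [d / C] of exceptional indices lifts the average above [b]
   by at most [d], whereas averages near [l] exceed [l - d = b + d]. *)
pose C := `|B| + `|b| + 1; have C0 : 0 < C by rewrite /C ltr_wpDl// addr_ge0.
have [N N0N cnt] := freq (d / C) N0.+1 (divr_gt0 d0 C0).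
have Npos : 0 < N%:R :> R by rewrite ltr0n (leq_trans _ N0N).
have := near_l N (ltnW N0N); rewrite /= /avg ltr_norml => /andP[_ lt1].
have : \sum_(i < N) a i <= b * N%:R + C * (\sum_(i < N) (b < a i)%R)%:R.
  rewrite natr_sum mulr_sumr -[N in b * N%:R]card_ord -sum1_card natr_sum mulr_sumr.
  rewrite -big_split /=; apply: ler_sum => i _.
  rewrite mulr1; case: ltP => ?; last by rewrite mulr0 addr0.
  rewrite mulr1 (le_trans (aB i))// /C.
  by have := ler_norm B; have := ler_norm (- b); rewrite normrN; lra.
move=> sum_le.
have : C * (\sum_(i < N) (b < a i)%R)%:R <= d * N%:R.
  have := ler_wpM2l (ltW C0) cnt.
  by congr (_ <= _); field; rewrite gt_eqF.
move=> le2.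
have : (\sum_(i < N) a i) / N%:R <= b + d.
  by rewrite ler_pdivrMr// mulrDl; lra.
by rewrite /d in lt1 *; lra.
Qed.

Definition is_cmean f (l : R[i]) : Prop :=
  is_mean (@complex.Re R \o f) (complex.Re l) /\
  is_mean (@complex.Im R \o f) (complex.Im l).

Lemma is_cmeanD f g l m :
  is_cmean f l -> is_cmean g m -> is_cmean (fun n => f n + g n) (l + m).
Proof.
move=> [fr fi] [gr gi]; split; rewrite ?cReD ?cImD.
  by apply: eq_is_mean (is_meanD fr gr) => n; rewrite /= cReD.
by apply: eq_is_mean (is_meanD fi gi) => n; rewrite /= cImD.
Qed.

Lemma is_cmeanZ c f l : is_cmean f l -> is_cmean (fun n => c * f n) (c * l).
Proof.
move=> [fr fi]; split; rewrite ?cReM ?cImM.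
  apply: eq_is_mean (is_meanB (is_meanZ fr) (is_meanZ fi)) => n.
  by rewrite /= cReM.
apply: eq_is_mean (is_meanD (is_meanZ fi) (is_meanZ fr)) => n.
by rewrite /= cImM.
Qed.

Lemma is_cmean_cst c : is_cmean (fun=> c) c.
Proof. by split; apply: is_mean_cst. Qed.

Lemma eq_is_cmean f g l : f =1 g -> is_cmean f l -> is_cmean g l.
Proof. by move/funext->. Qed.

End Means.

(** * Exponential means along progressions and equidistributed sequences *)

Section Equidistribution.
Context {R : realType}.

Lemma is_mean0_bounded (a : nat -> R) (B : R) :
  (forall N, `|\sum_(i < N) a i| <= B) -> is_mean a 0.
Proof.
move=> aB; apply/cvgrPdist_le => e e0; near=> N.
have N0 : 0 < N%:R :> R by rewrite ltr0n; near: N; exact: nbhs_infty_gt.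
rewrite sub0r normrN /avg normrM normfV [`|N%:R|]gtr0_norm// ler_pdivrMr//.
rewrite (le_trans (aB N))// mulrC -ler_pdivrMr//.
by near: N; exact: nbhs_infty_ger.
Unshelve. all: by end_near. Qed.

(** A geometric sum: irrationality of [alpha] keeps the ratio [z] away from 1, so the partial sums
    stay bounded. *)
Lemma mean_expi_progression (alpha : R) (h Q : nat) : (0 < Q)%N ->
  irrational alpha -> is_cmean (fun i => expi (alpha * (h + i * Q)%:R)) 0.
Proof.
move=> Q0 irr; set z := expi (alpha * Q%:R).
have z1 : z - 1 != 0.
  rewrite subr_eq0; apply/eqP => /expi_eq1 [k kE]; apply: irr; apply/rationalP.
  by exists k, Q; rewrite -kE mulfK// pnatr_eq0 -lt0n.
suff zn0 : is_cmean (fun i => z ^+ i) 0.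
  have := is_cmeanZ (expi (alpha * h%:R)) zn0; rewrite mulr0.
  apply: eq_is_cmean => i.
  by rewrite /z -expiMn -expiD; congr expi; rewrite natrD natrM; ring.
have [w sumE] : exists w, forall N,
    \sum_(i < N) z ^+ i = w * (expi (alpha * Q%:R * N%:R) - 1).
  by exists (z - 1)^-1 => N; rewrite expiMn subrX1 mulrA mulVf// mul1r.
split; apply: (@is_mean0_bounded _ (`|complex.Re w| * 2 + `|complex.Im w| * 2)) => N; rewrite /comp.
  rewrite -cRe_sum sumE cReM (le_trans (ler_normB _ _))// !normrM.
  apply: lerD; apply: ler_wpM2l => //=; rewrite (le_trans (ler_normD _ _))//.
    by have := cos_max (pi *+ 2 * (alpha * Q%:R * N%:R)); rewrite normrN normr1; lra.
  have := sin_max (pi *+ 2 * (alpha * Q%:R * N%:R)).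
  by rewrite oppr0 normr0; lra.
rewrite -cIm_sum sumE cImM (le_trans (ler_normD _ _))// !normrM.
apply: lerD; apply: ler_wpM2l => //=; rewrite (le_trans (ler_normD _ _))//.
  have := sin_max (pi *+ 2 * (alpha * Q%:R * N%:R)).
  by rewrite oppr0 normr0; lra.
by have := cos_max (pi *+ 2 * (alpha * Q%:R * N%:R)); rewrite normrN normr1; lra.
Qed.

Lemma mod1_itv (x : R) : 0 <= mod1 x < 1.
Proof.
by rewrite /mod1; have /andP[] := floor_itv x; rewrite intrD => ? ?; apply/andP; lra.
Qed.

Lemma unif_countE (x : nat -> R) (a b : R) (N : nat) :
  (unif_count x a b N)%:R = \sum_(i < N) (a <= mod1 (x i) < b)%R%:R :> R.
Proof.
rewrite /unif_count -sum1_card big_mkcond /= natr_sum; apply: eq_bigr => i _.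
by rewrite inE; case: ifP.
Qed.

(** Exactly one cell contains [m], that of index [floor (m K)], so the sum collapses to the value of
    [g] at its left end, at distance at most [1 / K]. *)
Lemma step_approx (g : R -> R) (L m : R) (K : nat) :
  (forall s t, `|g s - g t| <= L * `|s - t|) -> (0 < K)%N -> 0 <= L ->
  0 <= m < 1 ->
  `|g m - \sum_(j < K) g (j%:R / K%:R) * (j%:R / K%:R <= m < j.+1%:R / K%:R)%R%:R|
    <= L / K%:R.
Proof.
move=> gL K0 L0 /andP[m0 m1].
have K0' : 0 < K%:R :> R by rewrite ltr0n.
have := truncn_itv (mulr_ge0 m0 (ltW K0')); set j0 := Num.truncn _ => /andP[j0le j0lt].
have j0K : (j0 < K)%N by rewrite -(ltr_nat R); apply: le_lt_trans j0le _; rewrite gtr_pMl.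
rewrite (bigD1 (Ordinal j0K)) //= big1 ?addr0.
  rewrite ler_pdivrMr// ltr_pdivlMr// j0le j0lt mulr1 (le_trans (gL _ _))//.
  apply: ler_wpM2l => //; rewrite ger0_norm ?subr_ge0 ?ler_pdivrMr//.
  by rewrite -(@ler_pM2r _ K%:R)// mulrBl divfK ?gt_eqF// mulVf ?gt_eqF// lerBlDl natr1 ltW.
move=> j jj0; rewrite ler_pdivrMr// ltr_pdivlMr//.
case: andP => [[jle jlt]|]; last by rewrite mulr0.
case/eqP: jj0; apply/val_inj/eqP => /=.
rewrite eqn_leq; apply/andP; split; rewrite -ltnS -(ltr_nat R).
  exact: le_lt_trans jle j0lt.
exact: le_lt_trans j0le jlt.
Qed.

(** Antiperiodicity replaces integration: with an even number [K = 2 J] of cells of equal length,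
    the step values at [j] and [j + J] cancel, so the step function has mean 0 in the limit. *)
Lemma unif_distr_mean (x : nat -> R) (g : R -> R) (L : R) :
  unif_distr_mod1 x -> 0 < L ->
  (forall s t, `|g s - g t| <= L * `|s - t|) ->
  (forall t, g (t + 1 / 2) = - g t) ->
  is_mean (fun i => g (mod1 (x i))) 0.
Proof.
move=> ud L0 gL gN; apply/cvgrPdist_le => e e0.
pose J := (Num.truncn (L / e)).+1; pose K := (J + J)%N.
have J0 : 0 < J%:R :> R by rewrite ltr0n.
have K0 : 0 < K%:R :> R by rewrite ltr0n addn_gt0.
have LJ : L / K%:R <= e / 2.
  have : L / e < J%:R by rewrite truncnS_gt// divr_ge0// ltW.
  rewrite ltr_pdivrMr// ler_pdivrMr// natrD => ?; lra.
pose S N := \sum_(j < K) g (j%:R / K%:R) *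
   ((unif_count x (j%:R / K%:R) (j.+1%:R / K%:R) N)%:R / N%:R).
have S0 : S N @[N --> \oo] --> (0 : R).
  have -> : 0 = \sum_(j < K) g (j%:R / K%:R) * (j.+1%:R / K%:R - j%:R / K%:R) :> R.
    rewrite -[LHS](mul0r K%:R^-1) -[X in X * _](_ : \sum_(j < K) g (j%:R / K%:R) = 0).
      rewrite mulr_suml; apply: eq_bigr => j _.
      by congr (_ * _); rewrite -mulrBl -[j.+1%:R]natr1 [_ + 1]addrC addrK mul1r.
    rewrite big_split_ord /= -big_split /= big1// => j _.
    have -> : (J + j)%:R / K%:R = j%:R / K%:R + 1 / 2 :> R.
      rewrite /K !natrD; field; rewrite ?gt_eqF//; lra.
    by rewrite gN subrr.
  apply: cvg_big => [|j _]; first exact: add_continuous.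
  apply: cvgMl_tmp; apply: ud.
  - by rewrite divr_ge0.
  - by rewrite ltr_pM2r ?invr_gt0// ltr_nat.
  - by rewrite ler_pdivrMr// mul1r ler_nat.
have avgS N : `|avg (fun i => g (mod1 (x i))) N - S N| <= L / K%:R.
  have -> : S N = avg (fun i => \sum_(j < K) g (j%:R / K%:R) *
      (j%:R / K%:R <= mod1 (x i) < j.+1%:R / K%:R)%R%:R) N.
    rewrite /avg exchange_big mulr_suml /=; apply: eq_bigr => j _.
    by rewrite mulrA unif_countE -mulr_sumr.
  rewrite /avg -mulrBl -sumrB normrM normfV normr_nat.
  have [->|N0] := posnP N; first by rewrite invr0 mulr0 divr_ge0 ?ltW.
  rewrite ler_pdivrMr ?ltr0n// (le_trans (ler_norm_sum _ _ _))//.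
  have -> : L / K%:R * N%:R = \sum_(i < N) L / K%:R :> R.
    by rewrite sumr_const card_ord mulr_natr.
  apply: ler_sum => i _.
  by apply: step_approx => //; [exact: ltW|exact: mod1_itv].
move/cvgrPdist_le : S0 => /(_ (e / 2) (divr_gt0 e0 (ltr0n _ 2))) S0.
near=> N.
have := avgS N; have : `|0 - S N| <= e / 2 by near: N.
rewrite !sub0r !normrN => h1 h2.
rewrite -[avg _ N](subrK (S N)) (le_trans (ler_normD _ _))//.
by lra.
Unshelve. all: by end_near. Qed.

Lemma unif_distr_expi (x : nat -> R) :
  unif_distr_mod1 x -> is_cmean (fun i => expi (x i)) 0.
Proof.
move=> ud; have pi0 := @pi_gt0 R.
have modE y : expi (mod1 y) = expi y :> R[i] by rewrite /mod1 expiD -mulrNz expi_int mulr1.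
have p20 : 0 < pi *+ 2 :> R by rewrite mulrn_wgt0.
have half (t : R) : pi *+ 2 * (t + 1 / 2) = pi *+ 2 * t + pi by lra.
have lip (f : R -> R) : (forall s t, `|f s - f t| <= `|s - t|) ->
    forall s t, `|f (pi *+ 2 * s) - f (pi *+ 2 * t)| <= pi *+ 2 * `|s - t|.
  by move=> fL s t; rewrite (le_trans (fL _ _))// -mulrBr normrM [`|pi *+ 2|]gtr0_norm.
have sin_lipschitz (s t : R) : `|sin s - sin t| <= `|s - t|.
  rewrite -!cosBpihalf (le_trans (cos_lipschitz _ _))//.
  by rewrite opprB addrA subrK.
split.
  apply: (@eq_is_mean _ (fun i => cos (pi *+ 2 * mod1 (x i)))); last first.
    apply: (unif_distr_mean ud p20 (lip _ cos_lipschitz)) => t.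
    by rewrite half cosDpi.
  by move=> i; have /= [-> _] := modE (x i).
apply: (@eq_is_mean _ (fun i => sin (pi *+ 2 * mod1 (x i)))); last first.
  apply: (unif_distr_mean ud p20 (lip _ sin_lipschitz)) => t.
  by rewrite half sinDpi.
by move=> i; have /= [_ ->] := modE (x i).
Qed.

(* Equidistribution forbids any fixed value from being taken with positive
   density. *)
Lemma unif_distr_small_values (s : nat -> nat) (alpha : R) (n0 : nat) (k : R) :
  unif_distr_mod1 (fun i => (s i)%:R * alpha) -> 0 < k ->
  \forall N \near \oo, (\sum_(i < N) (s i < n0)%N)%:R <= k * N%:R :> R.
Proof.
move=> ud; elim: n0 k => [|n0 IH] k k0.
  by near=> N; rewrite big1 ?mulr_ge0// ltW.
pose t := mod1 (n0%:R * alpha); have /andP[t0 t1] : 0 <= t < 1 := mod1_itv _.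
(* The interval [t, b) holds the residue of [n0 * alpha] and is shorter than [k / 2], so its hitting
   frequency bounds that of the value [n0]; the minimum keeps [b] within the unit interval. *)
pose b := Num.min 1 (t + k / 4).
have tb : t < b by rewrite /b lt_min t1 ltrDl divr_gt0.
have b1 : b <= 1 by rewrite /b ge_min lexx.
have bt : b - t <= k / 4 by rewrite lerBlDl /b ge_min lexx orbT.
have k2 : 0 < k / 2 by rewrite divr_gt0.
have cv := ud t b t0 tb b1.
have lim_lt : b - t < k / 2 by lra.
near=> N.
have N0 : 0 < N%:R :> R by rewrite ltr0n; near: N; exact: nbhs_infty_gt.
have h1 : (\sum_(i < N) (s i < n0)%N)%:R <= k / 2 * N%:R :> R by near: N; exact: IH.
have h2 : (unif_count (fun i => (s i)%:R * alpha) t b N)%:R / N%:R <= k / 2 :> R.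
  by near: N; exact: cvgr_le cv _ lim_lt.
rewrite ler_pdivrMr// unif_countE in h2.
have h3 : (\sum_(i < N) (s i < n0.+1)%N)%:R <= (\sum_(i < N) (s i < n0)%N)%:R +
    \sum_(i < N) (t <= mod1 ((s i)%:R * alpha) < b)%R%:R :> R.
  rewrite !natr_sum -big_split /=; apply: ler_sum => i _.
  rewrite ltnS leq_eqVlt; case: eqP => [->|_] /=; last by rewrite lerDl.
  by rewrite ltnn lexx tb add0r.
by rewrite (le_trans h3)//; lra.
Unshelve. all: by end_near. Qed.

End Equidistribution.

(** * Trigonometric polynomials with frequencies in a subgroup *)

Section TrigPolynomials.
Context {R : realType} (T : set R).
Hypothesis T0 : T 0.
Hypothesis TB : forall x y : R, T x -> T y -> T (x - y).
Implicit Types (f g : nat -> R[i]) (y z : nat -> R).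

Let TN x : T x -> T (- x).
Proof. by move=> Tx; rewrite -sub0r; apply: TB. Qed.

Let TD (x y : R) : T x -> T y -> T (x + y).
Proof. by move=> Tx Ty; rewrite -[y]opprK; apply: TB => //; exact: TN. Qed.

Definition trig (s : seq (R[i] * R)) (n : nat) : R[i] :=
  \sum_(t <- s) t.1 * expi (t.2 * n%:R).

(** Frequencies are confined to the subgroup [T], so that sums, products and conjugates remain
    admissible and a single [Q] serves them all. *)
Definition tpoly f : Prop :=
  exists2 s, (forall t, t \in s -> T t.2) & f =1 trig s.

Lemma eq_tpoly f g : f =1 g -> tpoly f -> tpoly g.
Proof. by move/funext->. Qed.

Lemma tpoly_cst c : tpoly (fun=> c).
Proof.
exists [:: (c, 0)] => [t|n]; first by rewrite inE => /eqP ->.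
by rewrite /trig big_seq1 mul0r expi0 mulr1.
Qed.

Lemma tpolyD f g : tpoly f -> tpoly g -> tpoly (fun n => f n + g n).
Proof.
move=> [s sT fE] [s' sT' gE]; exists (s ++ s') => [t|n].
  by rewrite mem_cat => /orP[/sT|/sT'].
by rewrite /trig big_cat fE gE.
Qed.

Lemma tpolyM f g : tpoly f -> tpoly g -> tpoly (fun n => f n * g n).
Proof.
move=> [s sT fE] [s' sT' gE].
exists [seq (t.1 * t'.1, t.2 + t'.2) | t <- s, t' <- s'] => [u /allpairsP|n].
  by case=> -[t t'] /= [/sT Tt /sT' Tt' ->]; apply: TD.
rewrite /trig big_allpairs_dep fE gE /trig mulr_suml; apply: eq_bigr => t _.
by rewrite mulr_sumr; apply: eq_bigr => t' _; rewrite mulrDl expiD mulrACA.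
Qed.

Lemma tpolyJ f : tpoly f -> tpoly (fun n => conjc (f n)).
Proof.
move=> [s sT fE]; exists [seq (conjc t.1, - t.2) | t <- s] => [u /mapP[t ts ->]|n].
  exact/TN/sT.
rewrite /trig big_map fE /trig rmorph_sum; apply: eq_bigr => t _.
by rewrite rmorphM /= mulNr -conjc_expi.
Qed.

Definition rtpoly y : Prop := tpoly (fun n => (y n)%:C).

Lemma tpoly_Re f : tpoly f -> rtpoly (fun n => complex.Re (f n)).
Proof.
move=> fT; have := tpolyM (tpoly_cst 2^-1) (tpolyD fT (tpolyJ fT)).
by apply: eq_tpoly => n; rewrite ReJ_add mulrC.
Qed.

Lemma rtpoly_cst c : rtpoly (fun=> c).
Proof. exact: tpoly_cst. Qed.

Lemma rtpolyD y z : rtpoly y -> rtpoly z -> rtpoly (fun n => y n + z n).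
Proof. by move=> yT zT; apply: eq_tpoly (tpolyD yT zT) => n; rewrite rmorphD. Qed.

Lemma rtpolyM y z : rtpoly y -> rtpoly z -> rtpoly (fun n => y n * z n).
Proof. by move=> yT zT; apply: eq_tpoly (tpolyM yT zT) => n; rewrite rmorphM. Qed.

Lemma rtpolyZ c y : rtpoly y -> rtpoly (fun n => c * y n).
Proof. exact/rtpolyM/rtpoly_cst. Qed.

Lemma rtpoly_sum I (r : seq I) (P : pred I) (F : I -> nat -> R) :
  (forall i, P i -> rtpoly (F i)) -> rtpoly (fun n => \sum_(i <- r | P i) F i n).
Proof.
move=> FT; elim: r => [|i r IH].
  by apply: eq_tpoly (rtpoly_cst 0) => n; rewrite big_nil.
have [Pi|nPi] := boolP (P i).
  by apply: eq_tpoly (rtpolyD (FT i Pi) IH) => n; rewrite big_cons Pi.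
by apply: eq_tpoly IH => n; rewrite big_cons (negbTE nPi).
Qed.

Lemma rtpoly_horner y (p : {poly R}) : rtpoly y -> rtpoly (fun n => p.[y n]).
Proof.
move=> yT; elim/poly_ind: p => [|p c IH].
  by apply: eq_tpoly (rtpoly_cst 0) => n; rewrite horner0.
by apply: eq_tpoly (rtpolyD (rtpolyM IH yT) (rtpoly_cst c)) => n; rewrite hornerMXaddC.
Qed.

Lemma rtpoly_bounded y : rtpoly y -> exists2 B, 0 < B & forall n, `|y n| <= B.
Proof.
move=> [s _ yE].
pose b (t : R[i] * R) := `|complex.Re t.1| + `|complex.Im t.1|.
exists (1 + \sum_(t <- s) b t) => [|n].
  by rewrite ltr_pwDl// sumr_ge0// => t _; rewrite addr_ge0.
have -> : y n = complex.Re (trig s n) by rewrite -yE.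
rewrite /trig cRe_sum (le_trans (ler_norm_sum _ _ _))// ler_wpDl//.
apply: ler_sum => t _; rewrite cReM (le_trans (ler_normB _ _))// !normrM.
by apply: lerD; rewrite ler_piMr//= ?cos_max ?sin_max.
Qed.

(* Instances: the given [h + n_i Q] and the full progression [h + i Q]. *)
Definition sampling (Q h : nat) (s : nat -> nat) : Prop :=
  (forall i, exists m, s i = (h + m * Q)%N) /\
  forall alpha : R, irrational alpha ->
    is_cmean (fun i => expi (alpha * (s i)%:R)) 0.

Context (Q h : nat).
Hypothesis TQ : forall x, T x -> rational x -> exists k : int, x * Q%:R = k%:~R.

(** A step of length [Q] advances the phase by the integer [x * Q]. *)
Lemma expi_rational_class x m :
  T x -> rational x -> expi (x * (h + m * Q)%:R) = expi (x * h%:R).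
Proof.
move=> Tx /(TQ Tx)[k kE].
rewrite natrD natrM mulrDr [m%:R * _]mulrC mulrA kE expiD.
by rewrite [expi (k%:~R * _)]expiMn expi_int expr1n mulr1.
Qed.

(** Rational frequencies are constant on the class and contribute their value at [h]; irrational
    ones average out. The limit does not depend on [sg]. *)
Lemma trig_mean (s : seq (R[i] * R)) (sg : nat -> nat) :
  (forall t, t \in s -> T t.2) -> sampling Q h sg ->
  is_cmean (fun i => trig s (sg i))
    (\sum_(t <- s | `[< rational t.2 >]) t.1 * expi (t.2 * h%:R)).
Proof.
move=> + [sgc sgm]; elim: s => [|t s IH] sT.
  by rewrite big_nil; apply: eq_is_cmean (is_cmean_cst 0) => i; rewrite /trig big_nil.
have {}IH := IH (fun u us => sT u (mem_behead (s := t :: s) us)).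
have Tt := sT t (mem_head _ _).
rewrite big_cons; case: asboolP => [rt|irt].
  apply: eq_is_cmean (is_cmeanD (is_cmean_cst _) IH) => i.
  have [m ->] := sgc i.
  by rewrite /trig big_cons expi_rational_class.
rewrite -[X in is_cmean _ X]add0r -[X in X + _](mulr0 t.1).
apply: eq_is_cmean (is_cmeanD (is_cmeanZ t.1 (sgm _ irt)) IH) => i.
by rewrite /trig big_cons.
Qed.

(** Here [l] is chosen before [sg]: one number is the mean along every sampling of the class, which
    is what makes two samplings comparable. *)
Lemma rtpoly_mean y : rtpoly y ->
  exists l : R, forall sg, sampling Q h sg -> is_mean (fun i => y (sg i)) l.
Proof.
move=> [s sT yE]; eexists => sg /(trig_mean sT)[+ _]; apply: eq_is_mean => i.
by rewrite /= -yE.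
Qed.

(* With [e] the first frequency and [l] the mean of [f conj(e)], the mean of
   [|f - l e|^2] is [- |l|^2], so [l = 0]; hence all frequencies congruent to [e]
   on the class cancel out, and the others form a shorter sum. *)
Lemma trig_mean_sq_eq0 (s : seq (R[i] * R)) (sg : nat -> nat) :
  (forall t, t \in s -> T t.2) -> sampling Q h sg ->
  is_cmean (fun i => trig s (sg i) * conjc (trig s (sg i))) 0 ->
  forall m, trig s (h + m * Q) = 0.
Proof.
move=> + smp; have [n] := ubnP (size s); elim: n s => // n IH [|t0 s] /=.
  by move=> _ _ _ m; rewrite /trig big_nil.
rewrite ltnS => sn sT sq0; set f := trig (t0 :: s) in sq0 *.
pose x0 := t0.2; have Tx0 : T x0 := sT t0 (mem_head _ _).
pose e k : R[i] := expi (x0 * k%:R).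
pose s' := [seq (t.1, t.2 - x0) | t <- t0 :: s].
have s'T t : t \in s' -> T t.2 by move=> /mapP[u /sT Tu ->]; apply: TB.
have s'E k : trig s' k = f k * conjc (e k).
  rewrite /e conjc_expi /trig big_map mulr_suml; apply: eq_bigr => u _.
  by rewrite mulrBl expiD mulrA.
have := trig_mean s'T smp; set l := \sum_(_ <- s' | _) _ => fl.
have l0 : l = 0.
  have flJ : is_cmean (fun i => conjc (trig s' (sg i))) (conjc l).
    case: fl => fr fi; split.
      by move: fr; case: (l) => ? ?; apply: eq_is_mean => i /=; case: (trig _ _).
    have := is_meanZ (c := -1) fi; rewrite mulN1r /=; case: (l) => ? ? /=.
    by apply: eq_is_mean => i; rewrite /= mulN1r; case: (trig _ _).
  have := is_cmeanD (is_cmeanD sq0 (is_cmeanZ (- l) flJ))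
    (is_cmeanD (is_cmeanZ (- conjc l) fl) (is_cmean_cst (l * conjc l))).
  rewrite add0r (_ : _ + _ = - (l * conjc l)); last by ring.
  case=> + _; set v := (X in is_mean X _) => vm.
  have : 0 <= complex.Re (- (l * conjc l)).
    apply: is_mean_ge0 vm => i; rewrite /v /= s'E.
    set z := f (sg i); set w := e (sg i).
    have ww : w * conjc w = 1 by exact: mul_expiJ.
    (* Since [w] has modulus 1, the averaged expression is [|z - l w|^2]. *)
    rewrite (_ : _ + _ = (z - l * w) * conjc (z - l * w)).
      by case: (z - l * w) => a b /=; rewrite mulrN opprK -!expr2 addr_ge0 ?sqr_ge0.
    have -> : conjc (z - l * w) = conjc z - conjc l * conjc w.
      by rewrite rmorphB rmorphM.
    have -> : conjc (z * conjc w) = conjc z * w.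
      by rewrite rmorphM; congr (_ * _); exact: conjcK.
    rewrite -[X in _ + (_ + X)]mulr1 -ww; ring.
  case: (l) => a b; rewrite /= mulrN opprK -!expr2 oppr_ge0 => ab.
  have /andP[/eqP a0 /eqP b0] : (a ^+ 2 == 0) && (b ^+ 2 == 0).
    by rewrite -paddr_eq0 ?sqr_ge0// eq_le ab addr_ge0 ?sqr_ge0.
  by move/eqP: a0; move/eqP: b0; rewrite !sqrf_eq0 => /eqP -> /eqP ->.
pose s2 := [seq t <- s | ~~ `[< rational (t.2 - x0) >]].
(* The head [t0] has difference 0 and drops out, so [s2] is a sublist of the tail and the induction
   hypothesis applies. *)
have rat0 : rational (t0.2 - x0) by rewrite /x0 subrr; exists 0; rewrite ?rmorph0.
have fE m : f (h + m * Q)%N = trig s2 (h + m * Q).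
  rewrite /f /trig (bigID (fun t => `[< rational (t.2 - x0) >])) /=.
  rewrite [X in X + _](_ : _ = e (h + m * Q)%N * l); last first.
    rewrite /l big_map mulr_sumr big_seq_cond [RHS]big_seq_cond.
    apply: eq_bigr => t /andP[/sT Tt /asboolP rt] /=.
    rewrite mulrCA; congr (_ * _).
    rewrite -(@expi_rational_class (t.2 - x0) m)//; last exact: TB.
    by rewrite /e -expiD mulrBl addrC subrK.
  rewrite l0 mulr0 add0r big_cons asboolT//= /s2 big_filter.
  by apply: eq_bigl => t.
move=> m; rewrite fE; apply: IH.
- by rewrite size_filter (leq_ltn_trans (count_size _ _)).
- by move=> t; rewrite mem_filter => /andP[_ ts]; apply: sT; rewrite inE ts orbT.
- apply: eq_is_cmean sq0 => i.
  by have [k ->] := smp.1 i; rewrite fE.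
Qed.

(** A zero mean would make [y], which is its own conjugate, vanish on the whole class by
    [trig_mean_sq_eq0]. *)
Lemma rtpoly_mean_sq_gt0 y (sg : nat -> nat) l :
  rtpoly y -> sampling Q h sg -> is_mean (fun i => y (sg i) ^+ 2) l ->
  (exists m, y (h + m * Q)%N != 0) -> 0 < l.
Proof.
move=> [s sT yE] smp yl [m /eqP ym].
have l_ge0 : 0 <= l by apply: is_mean_ge0 yl => i; exact: sqr_ge0.
rewrite lt_neqAle l_ge0 andbT; apply/eqP => l0; apply: ym.
suff : trig s (h + m * Q) = 0 by rewrite -yE => -[].
apply: trig_mean_sq_eq0 sT smp _ m; rewrite -l0 in yl.
split; first by apply: eq_is_mean yl => i /=; rewrite -yE /= oppr0 mulr0 subr0.
apply: eq_is_mean (@is_mean_cst R 0) => i /=.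
by rewrite -yE /= oppr0 mulr0 mul0r addr0.
Qed.

End TrigPolynomials.

(** * Uniform polynomial approximation of the absolute value *)

Section AbsApproximation.
Context {R : realType}.

(** The classical iteration for the square root of [x^2]: from 0 it increases to [|x|] on
    [-1, 1]. *)
Fixpoint abs_poly (k : nat) : {poly R} :=
  if k is k'.+1 then abs_poly k' + 2^-1 *: ('X^2 - abs_poly k' ^+ 2) else 0.

(** With [a = |x|], each step multiplies the error [a - p] by [1 - (a + p) / 2 <= 1 - a / 2], and
    [(1 - a / 2) (2 + (k + 1) a) <= 2 + k a] propagates the third bound. That bound gives an error
    of at most [2 / k], uniformly in [x]. *)
Lemma abs_poly_bounds (k : nat) (x : R) (p := (abs_poly k).[x]) : `|x| <= 1 ->
  [/\ 0 <= p, p <= `|x| & (`|x| - p) * (2 + k%:R * `|x|) <= 2 * `|x|].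
Proof.
rewrite {}/p => x1; elim: k => [|k [p0 px IH]] /=.
  by rewrite horner0 mul0r addr0 subr0 mulrC.
rewrite hornerD hornerZ hornerD hornerN !horner_exp hornerX -(real_normK (num_real x)).
set a := `|x| in x1 p0 px IH *; set p := (abs_poly k).[x] in p0 px IH *.
have a0 : 0 <= a by rewrite normr_ge0.
have k0 : 0 <= k%:R :> R by [].
have half2 : 2^-1 * 2 = 1 :> R by rewrite mulVf.
have e0 : 0 <= a - p by rewrite subr_ge0.
have eE : a - (p + 2^-1 * (a ^+ 2 - p ^+ 2)) = (a - p) * (1 - 2^-1 * (a + p)) by field.
have h1 : 0 <= 1 - 2^-1 * (a + p) by lra.
split.
- by rewrite addr_ge0// mulr_ge0// subr_ge0 ler_sqr.
- by rewrite -subr_ge0 eE mulr_ge0.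
rewrite eE; apply: le_trans IH; rewrite -mulrA; apply: ler_wpM2l => //.
have ka : 0 <= k%:R * a by rewrite mulr_ge0.
apply: (@le_trans _ _ ((1 - 2^-1 * a) * (2 + (k%:R + 1) * a))).
  by rewrite -[k.+1%:R]natr1; apply: ler_wpM2r; [nra | lra].
have : 0 <= 2^-1 * a * (k%:R * a) by rewrite mulr_ge0// mulr_ge0// invr_ge0.
have : 0 <= 2^-1 * a * a by rewrite mulr_ge0// mulr_ge0// invr_ge0.
by nra.
Qed.

Lemma abs_approx (d : R) : 0 < d ->
  exists p : {poly R}, forall x, `|x| <= 1 -> `| `|x| - p.[x] | <= d.
Proof.
move=> d0; pose k := (Num.truncn (2 / d)).+1.
have k0 : 0 < k%:R :> R by rewrite ltr0n.
have kd : 2 <= d * k%:R.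
  by rewrite mulrC -ler_pdivrMr// ltW// truncnS_gt// divr_ge0// ltW.
exists (abs_poly k) => x /(abs_poly_bounds k)[]; set p := _.[x] => p0 px le2.
rewrite ger0_norm ?subr_ge0//; have [x0|x0] := eqVneq `|x| 0; first by lra.
have {x0} : 0 < `|x| by rewrite lt_neqAle eq_sym x0 normr_ge0.
set a := `|x| in px le2 *; move=> a0.
have : (a - p) * k%:R * a <= d * k%:R * a by nra.
by rewrite ler_pM2r// ler_pM2r.
Qed.

Lemma rtpoly_abs (T : set R) (y : nat -> R) (d : R) :
  T 0 -> (forall x y : R, T x -> T y -> T (x - y)) ->
  rtpoly T y -> 0 < d ->
  exists2 z, rtpoly T z & forall n, `| `|y n| - z n| <= d.
Proof.
move=> T0 TB yT d0; have [B B0 yB] := rtpoly_bounded yT.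
have [p pE] := abs_approx (divr_gt0 d0 B0).
exists (fun n => B * p.[B^-1 * y n]) => [|n].
  by apply: rtpolyZ => //; apply: rtpoly_horner => //; exact: rtpolyZ.
have -> : `|y n| = B * `|B^-1 * y n|.
  by rewrite normrM gtr0_norm ?invr_gt0// mulVKf// gt_eqF.
rewrite -mulrBr normrM gtr0_norm// mulrC -ler_pdivlMr//; apply: pE.
by rewrite normrM gtr0_norm ?invr_gt0// mulrC ler_pdivrMr// mul1r.
Qed.

End AbsApproximation.

(** * Torsion modulo 1 in finitely generated subgroups of the reals *)

Section IntegerSpan.
Context {R : realType}.

(** The subgroup generated by [s]; the recursion exposes the coefficient of the head generator, on
    which the induction of [zspan_torsion] acts. *)
Fixpoint zspan (s : seq R) (x : R) : Prop :=
  if s is t :: s' then exists k : int, zspan s' (x - k%:~R * t) else x = 0.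

Lemma zspan0 s : zspan s 0.
Proof. by elim: s => //= t s IH; exists 0; rewrite mul0r subr0. Qed.

Lemma zspanB s x y : zspan s x -> zspan s y -> zspan s (x - y).
Proof.
elim: s x y => [x y -> ->|t s IH x y [k kx] [l ly]] /=; first by rewrite subrr.
exists (k - l); rewrite (_ : _ - _ = (x - k%:~R * t) - (y - l%:~R * t)); first exact: IH.
by rewrite intrB; ring.
Qed.

Lemma zspanMz s x (m : int) : zspan s x -> zspan s (m%:~R * x).
Proof.
elim: s x => [x ->|t s IH x [k kx]] /=; first by rewrite mulr0.
by exists (m * k); rewrite intrM -mulrA -mulrBr; exact: IH.
Qed.

Lemma zspan_mem s x : x \in s -> zspan s x.
Proof.
elim: s => // t s IH; rewrite inE; case: eqP => [-> _|_ /IH xs] /=.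
  by exists 1; rewrite mul1r subrr; exact: zspan0.
by exists 0; rewrite mul0r subr0.
Qed.

Lemma rational_lin (a b : int) (x y : R) :
  rational x -> rational y -> rational (a%:~R * x - b%:~R * y).
Proof.
move=> [p _ <-] [q _ <-]; exists (a%:~R * p - b%:~R * q) => //.
by rewrite rmorphB !rmorphM /= !ratr_int.
Qed.

(* If [w] is rational with nonzero coefficient [g] on [t], then for rational [x]
   with coefficient [m] on [t], [g x - m w] has no [t]-component. *)
Lemma zspan_torsion s : exists2 Q, (0 < Q)%N &
  forall x, zspan s x -> rational x -> exists k : int, x * Q%:R = k%:~R.
Proof.
elim: s => [|t s [Q' Q'0 IH]].
  by exists 1%N => // x -> _; exists 0; rewrite mul0r.
(* Either some rational [w] has a nonzero coefficient [g] on [t], or all rational elements lie in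
   the span of [s] and [Q'] still works. *)
have [[g [w [g0 ws /rationalP[j [q wq]]]]]|none] :=
    pselect (exists (g : int) w, [/\ g != 0, zspan s (w - g%:~R * t) & rational w]); last first.
  exists Q' => // x [m xs] xr; apply: IH => //.
  suff m0 : m = 0 by rewrite m0 mul0r subr0 in xs.
  by apply: contrapT => /eqP m0; apply: none; exists m, x.
(* A denominator 0 encodes the value 0, as inversion sends 0 to 0; it is replaced by 1. *)
pose q' := if q is 0%N then 1%N else q.
have q'0 : (0 < q')%N by rewrite /q'; case: (q).
have [i wi] : exists i : int, w * q'%:R = i%:~R.
  rewrite wq /q'; case: (q) => [|q1]; first by exists 0; rewrite invr0 mulr0 mul0r.
  by exists j; rewrite divfK// pnatr_eq0.
(* From [w = i / q'] and [g x - m w = k / Q'], the three factors clear the denominators of [x]. *)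
exists (Q' * `|g| * q')%N => [|x [m xs] xr].
  by rewrite !muln_gt0 Q'0 q'0 absz_gt0 g0.
have wr : rational w by apply/rationalP; exists j, q.
have [|k kE] := IH (g%:~R * x - m%:~R * w) _ (rational_lin g m xr wr).
  rewrite (_ : _ - _ = g%:~R * (x - m%:~R * t) - m%:~R * (w - g%:~R * t)); last by ring.
  by apply: zspanB; exact: zspanMz.
exists (sgz g * (k * q'%:Z + m * i * Q'%:Z)).
rewrite intrM intrD !intrM -wi -kE -!pmulrn !natrM natr_absz.
have -> : (`|g|)%:~R = (sgz g)%:~R * g%:~R :> R by rewrite -intrM -abszEsg abszE.
by ring.
Qed.

End IntegerSpan.

(** * Exponential polynomials and matrix orbits *)

Section ExponentialPolynomials.
Context {F : fieldType} (S : F -> Prop).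
Hypothesis S0 : ~ S 0.
Implicit Types (u v : nat -> F) (r c : F).

(** Binomials replace powers of [n] because, by Pascal's rule, differencing lowers [d] by exactly
    one. *)
Definition epoly_sum (s : seq (F * (F * nat))) (n : nat) : F :=
  \sum_(t <- s) t.1 * t.2.1 ^+ n * 'C(n, t.2.2)%:R.

Definition epoly u : Prop :=
  exists2 s, (forall t, t \in s -> S t.2.1) & u =1 epoly_sum s.

Lemma epoly_term c r d : S r -> epoly (fun n => c * r ^+ n * 'C(n, d)%:R).
Proof.
move=> Sr; exists [:: (c, (r, d))] => [t|n]; first by rewrite inE => /eqP ->.
by rewrite /epoly_sum big_seq1.
Qed.

Lemma epolyD u v : epoly u -> epoly v -> epoly (fun n => u n + v n).
Proof.
move=> [s sS uE] [s' s'S vE]; exists (s ++ s') => [t|n].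
  by rewrite mem_cat => /orP[/sS|/s'S].
by rewrite /epoly_sum big_cat uE vE.
Qed.

Lemma epolyN u : epoly u -> epoly (fun n => - u n).
Proof.
move=> [s sS uE]; exists [seq (- t.1, t.2) | t <- s] => [t /mapP[w ws ->]|n].
  exact: sS ws.
rewrite /epoly_sum big_map uE /epoly_sum -sumrN; apply: eq_bigr => t _ /=.
by rewrite !mulNr.
Qed.

(** In the resonant case [mu = r], Pascal's rule gives a solution with [d] raised by one. Otherwise
    dividing by [mu - r] matches the leading term, and the error, a multiple of
    [mu ^+ n * 'C(n, d)], is removed by induction on the degree. *)
Lemma shift_surj_term r c mu d : S mu ->
  exists2 v, epoly v & forall n, v n.+1 - r * v n = c * mu ^+ n * 'C(n, d)%:R.
Proof.
move=> Smu; have mu0 : mu != 0 by apply: contra_notN S0 => /eqP <-.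
have [<-|rmu] := eqVneq mu r.
  exists (fun n => c / mu * mu ^+ n * 'C(n, d.+1)%:R); first exact: epoly_term.
  by move=> n; rewrite binS natrD exprS; field.
have b0 : mu - r != 0 by rewrite subr_eq0.
elim: d c => [|d IH] c.
  exists (fun n => c / (mu - r) * mu ^+ n * 'C(n, 0)%:R); first exact: epoly_term.
  by move=> n; rewrite !bin0 exprS; field.
have [v vE vn] := IH (c / (mu - r) * mu).
exists (fun n => c / (mu - r) * mu ^+ n * 'C(n, d.+1)%:R + - v n).
  by apply: epolyD; [exact: epoly_term | exact: epolyN].
move=> n; have vS : v n.+1 = r * v n + c / (mu - r) * mu * mu ^+ n * 'C(n, d)%:R.
  by rewrite -vn addrC subrK.
by rewrite vS binS natrD exprS; field.
Qed.

Lemma shift_surj r u : epoly u ->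
  exists2 v, epoly v & forall n, v n.+1 - r * v n = u n.
Proof.
move=> [s + uE]; elim: s u uE => [|[c [mu d]] s IH] u uE sS.
  exists (fun=> 0) => [|n]; last by rewrite uE /epoly_sum big_nil mulr0 subr0.
  by exists [::] => // n; rewrite /epoly_sum big_nil.
have [v1 v1S v1E] := shift_surj_term r c d (sS (c, (mu, d)) (mem_head _ _)).
have [|v2 v2S v2E] := IH (epoly_sum s) (fun=> erefl).
  by move=> t ts; apply: sS; rewrite inE ts orbT.
exists (fun n => v1 n + v2 n) => [|n]; first exact: epolyD.
by have := v2E n; rewrite uE /epoly_sum big_cons /= -v1E => <-; ring.
Qed.

Context {k : nat} (M : 'M[F]_k).

(** The product of the factors [M - r] applied to [v]. *)
Definition annih (rs : seq F) (v : 'cV[F]_k) : 'cV[F]_k :=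
  foldl (fun w r => M *m w - r *: w) v rs.

(* The eigenvalue 0 contributes only finitely many nonzero terms. *)
Lemma orbit_epoly (rs : seq F) (v : 'cV[F]_k) (i : 'I_k) :
  (forall r, r \in rs -> r != 0 -> S r) -> annih rs v = 0 ->
  exists N, exists2 u, epoly u &
    forall n, (N <= n)%N -> iter n (mulmx M) v i 0 = u n.
Proof.
elim: rs v => [|r rs IH] v rsS /= v0.
  exists 0%N, (fun=> 0); first by exists [::] => // n; rewrite /epoly_sum big_nil.
  move=> n _; rewrite v0 (_ : iter n _ _ = 0) ?mxE//.
  by elim: n => //= n ->; rewrite mulmx0.
have [N [u uS uE]] := IH _ (fun r' h => rsS r' (mem_behead (s := r :: rs) h)) v0.
pose x n := iter n (mulmx M) v i 0.
have xE n : (N <= n)%N -> x n.+1 - r * x n = u n.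
  move=> /uE <-; rewrite /x.
  suff -> : iter n (mulmx M) (M *m v - r *: v) =
      iter n.+1 (mulmx M) v - r *: iter n (mulmx M) v by rewrite !mxE.
  by elim: n => // n IHn; rewrite iterS IHn mulmxBr -scalemxAr.
(* Subtracting a particular solution [p] leaves a remainder [y] with [y (n + 1) = r y n] from [N]
   on. *)
have [p pS pE] := shift_surj r uS.
pose y n := x n - p n.
have yE j : y (N + j)%N = r ^+ j * y N.
  elim: j => [|j IHj]; first by rewrite addn0 expr0 mul1r.
  rewrite addnS exprS -mulrA -IHj /y; have := xE (N + j)%N (leq_addr _ _).
  by rewrite -pE => /eqP; rewrite subr_eq => /eqP ->; ring.
(* For [r = 0] the remainder vanishes after index [N]; otherwise it is one more exponential term,
   with base [r]. *)
have [r0|r0] := eqVneq r 0.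
  exists N.+1, p => // n Nn; apply/eqP; rewrite -subr_eq0.
  rewrite -(subnKC (ltnW Nn)) -/(x _) -/(y _) yE r0 expr0n subn_eq0 leqNgt Nn.
  by rewrite mul0r.
exists N, (fun n => p n + y N / r ^+ N * r ^+ n * 'C(n, 0)%:R).
  by apply: epolyD => //; apply: epoly_term; apply: rsS => //; exact: mem_head.
move=> n Nn; rewrite bin0 mulr1 -(subnKC Nn) exprD mulrA divfK ?expf_neq0//.
by rewrite [y N * _]mulrC -yE /y -/(x _) addrC subrK.
Qed.

End ExponentialPolynomials.

(** The characteristic polynomial splits, and by Cayley-Hamilton its linear factors evaluated at [M]
    multiply to 0. *)
Lemma annih_char_poly (F : closedFieldType) (k : nat) (M : 'M[F]_k) :
  exists rs, forall v, annih M rs v = 0.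
Proof.
case: k M => [|k] M; first by exists [::] => v; exact: flatmx0.
have [rs rsE] := closed_field_poly_normal (char_poly M).
exists rs => v; rewrite (monicP (char_poly_monic M)) scale1r in rsE.
have annihE : annih M rs v = horner_mx M (\prod_(z <- rs) ('X - z%:P)) *m v.
  elim: rs v {rsE} => [|r rs IH] v; first by rewrite big_nil rmorph1 mul1mx.
  rewrite big_cons mulrC rmorphM /= -mulmxA -IH; congr annih.
  by rewrite rmorphB /= horner_mx_X horner_mx_C mulmxBl mul_scalar_mx.
by rewrite annihE -rsE Cayley_Hamilton mul0mx.
Qed.

(** * Growth rates and the leading part of an orbit *)

Section Growth.
Context {R : realType}.
Implicit Types (g : R * nat).

Definition grow g (n : nat) : R := g.1 ^+ n * 'C(n, g.2)%:R.

Definition grow_lt g g' : bool := (g.1 < g'.1) || (g.1 == g'.1) && (g.2 < g'.2)%N.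

Lemma grow_gt0 g n : 0 < g.1 -> (g.2 <= n)%N -> 0 < grow g n.
Proof. by move=> g0 gn; rewrite mulr_gt0 ?exprn_gt0// ltr0n bin_gt0. Qed.

(* [C(n, d) x^d <= (1 + x)^n], with [x] such that [q (1 + x) = (1 + q) / 2]. *)
Lemma cvg_geometric_bin (q : R) (d : nat) : 0 < q < 1 ->
  q ^+ n * 'C(n, d)%:R @[n --> \oo] --> (0 : R).
Proof.
move=> /andP[q0 q1].
have [x x0 qx] : exists2 x, 0 < x & q * (1 + x) = (1 + q) / 2.
  exists ((q^-1 - 1) / 2); first by rewrite divr_gt0// subr_gt0 invf_gt1.
  by field; rewrite gt_eqF.
apply: (@squeeze_cvgr _ _ _ _ (fun=> 0) (geometric (x ^- d) ((1 + q) / 2))).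
- apply: nearW => n; rewrite mulr_ge0 ?exprn_ge0 ?(ltW q0)//= /geometric -qx /=.
  rewrite exprMn mulrCA ler_wpM2l ?exprn_ge0 ?(ltW q0)// [X in _ <= X]mulrC ler_pdivlMr ?exprn_gt0//.
  have [dn|nd] := leqP d n; last by rewrite bin_small// mul0r exprn_ge0// addr_ge0// (ltW x0).
  rewrite exprDn (bigD1 (Ordinal (dn : (d < n.+1)%N)))//= expr1n mul1r mulr_natl lerDl.
  by apply: sumr_ge0 => i _; rewrite mulrn_wge0// expr1n mul1r exprn_ge0// (ltW x0).
- exact: cvg_cst.
- by apply: cvg_geometric; rewrite ger0_norm; lra.
Qed.

(** Consecutive binomials have ratio [(c + 1) / (n - c)]; a larger gap is a product of such
    ratios. *)
Lemma cvg_bin_ratio (d j : nat) :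
  ('C(n, d)%:R / 'C(n, d + j.+1)%:R : R) @[n --> \oo] --> (0 : R).
Proof.
have step c : ('C(n, c)%:R / 'C(n, c.+1)%:R : R) @[n --> \oo] --> (0 : R).
  apply/cvgrPdist_le => e e0; near=> n.
  have cn : (c < n)%N by near: n; exact: nbhs_infty_gt.
  have C0 : 0 < 'C(n, c.+1)%:R :> R by rewrite ltr0n bin_gt0.
  rewrite sub0r normrN ger0_norm ?divr_ge0// ler_pdivrMr//.
  have /(congr1 (fun m => m%:R : R)) := mul_bin_left n c.
  rewrite !natrM => binE.
  have nc : c.+1%:R / e <= (n - c)%:R.
    rewrite natrB ?(ltnW cn)// lerBrDr.
    by near: n; exact: nbhs_infty_ger.
  rewrite ler_pdivrMr// in nc.
  have c0 : 0 < c.+1%:R :> R by rewrite ltr0n.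
  rewrite -(ler_pM2l c0) mulrCA binE mulrA; apply: ler_wpM2r => //.
  by rewrite mulrC.
elim: j => [|j IH]; first by rewrite addn1.
have : ('C(n, d)%:R / 'C(n, d + j.+1)%:R) *
    ('C(n, d + j.+1)%:R / 'C(n, (d + j.+1).+1)%:R) @[n --> \oo] --> (0 * 0 : R).
  exact: cvgM IH (step _).
rewrite mulr0 [(d + j.+2)%N]addnS; apply: cvg_trans; apply: near_eq_cvg.
near=> n; rewrite mulrA divfK// pnatr_eq0 -lt0n bin_gt0.
by near: n; exact: nbhs_infty_ge.
Unshelve. all: by end_near. Qed.

(** For distinct bases the denominator's binomial, at least 1, is dropped and [cvg_geometric_bin]
    applies; for equal bases only binomials remain. *)
Lemma cvg_grow_ratio g g' : 0 < g.1 -> 0 < g'.1 -> grow_lt g g' ->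
  grow g n / grow g' n @[n --> \oo] --> (0 : R).
Proof.
case: g g' => [r d] [r' d'] /= r0 r'0 /orP[/= rr'|/= /andP[/eqP <- dd']].
  have q1 : 0 < r / r' < 1 by rewrite divr_gt0//= ltr_pdivrMr// mul1r.
  apply: (@squeeze_cvgr _ _ _ _ (fun=> 0) (fun n => (r / r') ^+ n * 'C(n, d)%:R)).
  - near=> n; have d'n : (d' <= n)%N by near: n; exact: nbhs_infty_ge.
    rewrite /grow/= divr_ge0 ?mulr_ge0 ?exprn_ge0 ?(ltW r0) ?(ltW r'0)//=.
    rewrite ler_pdivrMr ?(@grow_gt0 (r', d'))// expr_div_n.
    rewrite [X in _ <= X](_ : _ = r ^+ n * 'C(n, d)%:R * 'C(n, d')%:R).
      rewrite ler_peMr ?mulr_ge0 ?exprn_ge0 ?(ltW r0)//.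
      by rewrite ler1n bin_gt0.
    by field; rewrite expf_neq0// gt_eqF.
  - exact: cvg_cst.
  - exact: cvg_geometric_bin.
have := @cvg_bin_ratio d (d' - d.+1); rewrite addnS -addSn subnKC//.
apply: cvg_trans; apply: near_eq_cvg; apply: nearW => n.
by rewrite /grow/= -mulf_div divff ?mul1r// expf_neq0// gt_eqF.
Unshelve. all: by end_near. Qed.

Lemma grow_max (s : seq (R * nat)) : s != [::] ->
  exists2 g0, g0 \in s & forall g, g \in s -> g != g0 -> grow_lt g g0.
Proof.
elim: s => // a [_ _|b s IH _].
  by exists a => [|g]; rewrite inE ?eqxx// => ->.
have [//|g0 g0s g0max] := IH.
have tr : grow_lt g0 a -> forall g, grow_lt g g0 -> grow_lt g a.
  rewrite /grow_lt => h1 g h2; move: h1 h2.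
  case: ltgtP => //= [h1 _|->] ; last first.
    move=> h1 /orP[->//|/andP[-> /= h2]]; by rewrite (ltn_trans h2 h1) orbT.
  by case: ltgtP => //= [h2 _|-> _]; rewrite ?(lt_trans h2 h1)// h1.
have [ag0|ag0] := boolP (grow_lt g0 a).
  exists a => [|g]; first exact: mem_head.
  rewrite inE => /orP[->//|gs _]; have [->//|gg0] := eqVneq g g0.
  exact/tr/g0max.
exists g0 => [|g]; first by rewrite inE g0s orbT.
rewrite inE => /orP[/eqP -> ang0|]; last exact: g0max.
move: ag0; rewrite /grow_lt; case: ltgtP => //= e; rewrite -leqNgt => ag.
rewrite ltn_neqAle ag andbT; apply: contra ang0 => /eqP e2.
by case: a g0 e e2 {g0s g0max tr ag} => [? ?] [? ?] /= -> ->.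
Qed.

Lemma cvg0_mul_bounded (a b : nat -> R) (B : R) :
  a @ \oo --> (0 : R) -> (forall n, `|b n| <= B) ->
  a n * b n @[n --> \oo] --> (0 : R).
Proof.
move=> a0 bB; have B0 : 0 <= B := le_trans (normr_ge0 _) (bB 0%N).
have B1 : 0 < B + 1 by rewrite ltr_wpDl.
apply/cvgrPdist_le => e e0; near=> n.
have an : `|0 - a n| <= e / (B + 1).
  by near: n; move/cvgrPdist_le : a0; apply; rewrite divr_gt0.
move: an; rewrite !sub0r !normrN normrM ler_pdivlMr// => an.
have := normr_ge0 (a n); have := bB n; have := normr_ge0 (b n).
nra.
Unshelve. all: by end_near. Qed.

(** [g0] is the largest growth whose coefficient is not identically zero on the class. Growths with
    vanishing coefficients contribute nothing there, however large, and the remaining ones are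
    negligible against [g0]. *)
Lemma leading_part (I : finType) (G : seq (R * nat)) (Y : R * nat -> I -> nat -> R)
    (u : nat -> I -> R) (N h Q : nat) :
  uniq G -> (forall g, g \in G -> 0 < g.1) -> (0 < Q)%N ->
  (forall g i, exists B, forall n, `|Y g i n| <= B) ->
  (forall n i, (N <= n)%N -> u n i = \sum_(g <- G) grow g n * Y g i n) ->
  (forall n, exists i, u n i != 0) ->
  exists2 g0, (exists i m, Y g0 i (h + m * Q)%N != 0) &
    forall i d, 0 < d -> \forall n \near \oo, 0 < grow g0 n /\
      forall m, n = (h + m * Q)%N -> `|u n i / grow g0 n - Y g0 i n| <= d.
Proof.
move=> Guniq Gpos Q0 Ybd uE u0.
pose P g := `[< exists i m, Y g i (h + m * Q)%N != 0 >].
have Y0 g i m : ~~ P g -> Y g i (h + m * Q)%N = 0.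
  by move=> /asboolPn nP; apply: contrapT => /eqP ?; apply: nP; exists i, m.
have [g0] : exists2 g0, g0 \in [seq g <- G | P g] &
    forall g, g \in [seq g <- G | P g] -> g != g0 -> grow_lt g g0.
  apply: grow_max; apply/eqP => G0.
  (* The index [h + N * Q] lies in the class and is at least [N]; were all coefficients zero on the
     class, the vector [u] would vanish there. *)
  have [j] := u0 (h + N * Q)%N; rewrite uE ?big_seq ?big1 ?eqxx//.
    move=> g gG; rewrite Y0 ?mulr0//; apply/negP => Pg.
    have : g \in [seq g <- G | P g] by rewrite mem_filter Pg.
    by rewrite G0.
  by rewrite (leq_trans (leq_pmulr _ Q0))// leq_addl.
rewrite mem_filter => /andP[Pg0 g0G] g0max; exists g0; first exact/asboolP.
move=> i d d0.
have w0 : \sum_(g <- G | P g && (g \in G) && (g != g0)) grow g n / grow g0 n * Y g i n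
    @[n --> \oo] --> (0 : R).
  have zero : 0 = \sum_(g <- G | P g && (g \in G) && (g != g0)) 0 :> R by rewrite big1.
  rewrite [X in _ --> X]zero.
  apply: cvg_big => [|g /andP[/andP[Pg gG] gg0]]; first exact: add_continuous.
  have [B YB] := Ybd g i; apply: cvg0_mul_bounded YB.
  by apply: cvg_grow_ratio; rewrite ?Gpos// g0max// mem_filter Pg.
near=> n.
have gn : 0 < grow g0 n.
  by rewrite grow_gt0 ?Gpos//; near: n; exact: nbhs_infty_ge.
split=> // m nE.
have wn : `|0 - \sum_(g <- G | P g && (g \in G) && (g != g0))
    grow g n / grow g0 n * Y g i n| <= d.
  by near: n; move/cvgrPdist_le : w0; exact.
rewrite uE; last by near: n; exact: nbhs_infty_ge.
rewrite mulr_suml (bigD1_seq g0)//= [grow g0 n * _]mulrC mulfK ?gt_eqF// addrAC subrr add0r.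
move: wn; rewrite sub0r normrN; congr (_ <= _); congr `|_|.
rewrite [RHS](bigID P)/= [X in _ = _ + X]big1 ?addr0; last first.
  by move=> g /andP[_ nP]; rewrite nE Y0// mulr0 mul0r.
rewrite big_seq_cond [RHS]big_seq_cond; apply: eq_big => [g|g _]; last by rewrite mulrAC.
by case: (g \in G); rewrite ?andbF//= andbT andbC.
Unshelve. all: by end_near. Qed.

Lemma sum_fibers (I J : eqType) (V : nmodType) (G : seq J) (s : seq I) (gr : I -> J)
    (f : I -> V) : uniq G -> (forall t, t \in s -> gr t \in G) ->
  \sum_(t <- s) f t = \sum_(g <- G) \sum_(t <- s | gr t == g) f t.
Proof.
move=> Guniq sG; under [RHS]eq_bigr do rewrite big_mkcond.
rewrite exchange_big /= [LHS]big_seq [RHS]big_seq; apply: eq_bigr => t ts.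
rewrite (bigD1_seq (gr t)) ?sG//= eqxx big1 ?addr0// => g gt.
by rewrite eq_sym (negbTE gt).
Qed.

(** Over the complex numbers each coordinate is an exponential polynomial. Terms are grouped by
    modulus of the eigenvalue and binomial degree; the phases left over form trigonometric
    polynomials with frequencies in the span of the arguments, and real parts return to [R]. *)
Lemma orbit_growth (k : nat) (M : 'M[R]_k) (v : 'cV[R]_k) :
  exists (th : seq R) (G : seq (R * nat)) (Y : R * nat -> 'I_k -> nat -> R) (N : nat),
    [/\ uniq G, (forall g, g \in G -> 0 < g.1),
      (forall g i, rtpoly (zspan th) (Y g i)) &
      forall n i, (N <= n)%N ->
        iter n (mulmx M) v i 0 = \sum_(g <- G) grow g n * Y g i n].
Proof.
pose toC : R -> R[i] := real_complex R.
have [rs rs0] := annih_char_poly (map_mx toC M).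
have /choice[arg argP] (z : R[i]) : exists x, z != 0 -> z = (cabs z)%:C * expi x.
  by have [->|/polarP[x zx]] := eqVneq z 0; [exists 0|exists x].
pose S z := z \in rs /\ z != 0.
have S0 : ~ S 0 by case; rewrite eqxx.
have /choice[D DP] (i : 'I_k) : exists D : nat * seq (R[i] * (R[i] * nat)),
    (forall t, t \in D.2 -> S t.2.1) /\
    forall n, (D.1 <= n)%N -> toC (iter n (mulmx M) v i 0) = epoly_sum D.2 n.
  have [N [u [s sS uE] xE]] :=
    orbit_epoly S0 i (fun r rrs r0 => conj rrs r0) (rs0 (map_mx toC v)).
  exists (N, s); split=> // n Nn; rewrite -uE -xE//.
  suff -> : iter n (mulmx (map_mx toC M)) (map_mx toC v) =
      map_mx toC (iter n (mulmx M) v).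
    by rewrite mxE.
  by elim: n {Nn} => //= n ->; rewrite map_mxM.
pose gr (t : R[i] * (R[i] * nat)) : R * nat := (cabs t.2.1, t.2.2).
pose Y g i n := complex.Re (\sum_(t <- (D i).2 | gr t == g) t.1 * expi (arg t.2.1 * n%:R)).
exists [seq arg z | z <- rs].
exists (undup [seq gr t | t <- flatten [seq (D i).2 | i <- enum 'I_k]]), Y.
exists (\max_i (D i).1)%N.
have DG i t : t \in (D i).2 ->
    gr t \in undup [seq gr t | t <- flatten [seq (D i).2 | i <- enum 'I_k]].
  move=> tD; rewrite mem_undup; apply: map_f; apply/flattenP; exists (D i).2 => //.
  by apply: map_f; rewrite mem_enum.
split; first exact: undup_uniq.
- move=> g; rewrite mem_undup => /mapP[t /flattenP[_ /mapP[i _ ->] tD] ->] /=.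
  by rewrite cabs_gt0//; case: ((DP i).1 t tD).
- move=> g i; apply: tpoly_Re; [exact: zspan0|exact: zspanB|].
  exists [seq (t.1, arg t.2.1) | t <- [seq t <- (D i).2 | gr t == g]].
    move=> _ /mapP[t + ->]; rewrite mem_filter => /andP[_ tD]; apply: zspan_mem.
    by apply: map_f; case: ((DP i).1 t tD).
  by move=> n; rewrite /trig big_map big_filter.
move=> n i Nn.
have -> : iter n (mulmx M) v i 0 = complex.Re (toC (iter n (mulmx M) v i 0)) by [].
rewrite (DP i).2; last by rewrite (leq_trans _ Nn)// (leq_bigmax (F := fun i => (D i).1) i).
rewrite /epoly_sum (sum_fibers _ (undup_uniq _) (DG i)) cRe_sum; apply: eq_bigr => g _.
rewrite /Y !cRe_sum mulr_sumr big_seq_cond [RHS]big_seq_cond.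
apply: eq_bigr => t /andP[tD /eqP <-].
have [_ tn0] := (DP i).1 t tD.
rewrite {1}(argP _ tn0) exprMn -expiMn /grow /=.
rewrite (_ : _ * _ * _ =
  (cabs t.2.1 ^+ n * 'C(n, t.2.2)%:R)%:C * (t.1 * expi (arg t.2.1 * n%:R))).
  by rewrite cReM /= mul0r subr0.
by rewrite rmorphM rmorphXn rmorph_nat /=; ring.
Qed.

End Growth.

(** * Counting and zero lower density along progressions *)

Lemma sum_ltn_const (N n : nat) : (\sum_(i < N) (i < n) = minn N n)%N.
Proof.
elim: N => [|N IH]; first by rewrite big_ord0 min0n.
rewrite big_ord_recr /= IH; case: (ltnP N n) => Nn; last first.
  by rewrite addn0 !(minn_idPr _)// leqW.
by rewrite addn1 !(minn_idPl _)// ltnW.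
Qed.

Section Density.
Context {R : realType}.

(** The lower limit is the supremum of the tail infima, so the infimum past [n1] is at most 0 and
    some ratio there is below [k]. *)
Lemma lower_dens0_frequently (L : language unit) (k : R) (n1 : nat) :
  lower_dens R L = 0%E -> 0 < k ->
  exists2 n, (n1 <= n)%N &
    #|[pred i : 'I_n.+1 | apow i \in L]|%:R <= k * n.+1%:R.
Proof.
rewrite /lower_dens; set u := (X in limn_einf X) => u0 k0.
have : (einfs u n1 <= 0)%E.
  rewrite -u0 limn_einf_lim.
  rewrite (cvg_lim _ (@cvg_einfs_sup _ u))//.
  by apply: ereal_sup_ubound; exists n1.
move=> /le_lt_trans/(_ (_ : (0 < k%:E)%E)).
rewrite lte_fin => /(_ k0) /ereal_inf_lt[_ [n /= n1n <-]].
rewrite /u lte_fin ltr_pdivrMr// => /ltW ?.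
by exists n.
Qed.

(** The first [N] members of the class inject into the integers up to [n], and
    [n + 1 <= N (Q + h + Q)], so passing to the class costs a constant factor in density. *)
Lemma progression_frequently (L : language unit) (h Q : nat) (k : R) (N0 : nat) :
  lower_dens R L = 0%E -> (0 < Q)%N -> 0 < k ->
  exists2 N, (N0 <= N)%N &
    (\sum_(i < N) (apow (h + i * Q) \in L))%:R <= k * N%:R.
Proof.
move=> L0 Q0 k0.
have W0 : 0 < (Q + h + Q)%:R :> R by rewrite ltr0n addn_gt0 Q0 orbT.
(* This lower bound on [n] forces [N > N0], in particular [N >= 1], which absorbs [h] and the
   remainder modulo [Q]. *)
have [n nge cnt] := lower_dens0_frequently (h + N0.+1 * Q) L0 (divr_gt0 k0 W0).
pose N := ((n - h) %/ Q)%N.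
have NN0 : (N0.+1 <= N)%N by rewrite /N leq_divRL// leq_subRL// (leq_trans (leq_addr _ _) nge).
have hn : (h <= n)%N := leq_trans (leq_addr _ _) nge.
have lt_n (i : 'I_N) : (h + i * Q < n.+1)%N.
  rewrite ltnS -leq_subRL// -leq_divRL// ltnW//.
exists N; first exact: ltnW.
pose f (i : 'I_N) : 'I_n.+1 := Ordinal (lt_n i).
have f_inj : injective f.
  move=> i j /(congr1 val)/= /addnI/eqP; rewrite eqn_pmul2r// => /eqP ij.
  exact: val_inj.
have le1 : (\sum_(i < N) (apow (h + i * Q) \in L) <= #|[pred i : 'I_n.+1 | apow i \in L]|)%N.
  rewrite -big_mkcond /= sum1_card -(fintype.card_image f_inj); apply: subset_leq_card.
  by apply/fintype.subsetP => j /fintype.imageP[i iL ->].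
have le2 : (n.+1 <= N * (Q + h + Q))%N.
  have N_gt0 : (0 < N)%N by exact: leq_trans NN0.
  have nE : n.+1 = (N * Q + h + ((n - h) %% Q).+1)%N.
    by rewrite addnS -addnA [(h + _)%N]addnC addnA -divn_eq subnK.
  rewrite nE !mulnDr leq_add//; first by rewrite leq_add2l leq_pmull.
  by rewrite (leq_trans _ (leq_pmull Q N_gt0))// ltn_pmod.
apply: le_trans (_ : k / (Q + h + Q)%:R * n.+1%:R <= _).
  by apply: le_trans cnt; rewrite ler_nat.
rewrite -mulrA; apply: ler_wpM2l; first exact: ltW.
by rewrite mulrC ler_pdivrMr// -natrM ler_nat.
Qed.

End Density.

(** * States of a unary affine automaton *)

Lemma affine_vec_mul (R : realType) (k : nat) (M : 'M[R]_k) (v : 'cV[R]_k) :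
  affine_mx M -> affine_vec v -> affine_vec (M *m v).
Proof.
move=> Ma va; rewrite /affine_vec; under eq_bigr do rewrite mxE.
rewrite exchange_big /= -[RHS]va; apply: eq_bigr => j _.
rewrite -mulr_suml -[RHS]mul1r -[in RHS](Ma j); congr (_ * _).
by apply: eq_bigr => i _; rewrite mxE.
Qed.

Lemma afa_final_apow (R : realType) (A : AfA R unit) (n : nat) :
  afa_final A (apow n) = iter n (mulmx (afa_mx A tt)) (afa_init A).
Proof.
rewrite /afa_final /afa_word_mx /apow.
suff gen X : foldl (fun M x => afa_mx A x *m M) X (nseq n tt) *m afa_init A =
    iter n (mulmx (afa_mx A tt)) (X *m afa_init A) by rewrite gen mul1mx.
by elim: n X => // n IH X; rewrite iterSr mulmxA -IH.
Qed.

(** * The acceptance margin and its perturbation *)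

Section HalfSign.
Context (R : realType) (I : finType) (acc : {set I}).
Implicit Types v w : I -> R.

(** Weights that turn [W] into a linear form in the absolute values; on a nonzero state its sign
    tells whether the acceptance ratio exceeds 1/2. *)
Definition half_sign (i : I) : R := if i \in acc then 1 / 2 else - (1 / 2).

Lemma half_sign_sum w :
  \sum_i half_sign i * w i = \sum_(i in acc) w i - 1 / 2 * \sum_i w i.
Proof.
rewrite mulr_sumr [X in _ = X - _]big_mkcond -sumrB; apply: eq_bigr => i _.
by rewrite /half_sign; case: ifP => _; lra.
Qed.

Lemma half_sign_close (d : R) v w : (forall i, `|v i - w i| <= d) ->
  `|\sum_i half_sign i * v i - \sum_i half_sign i * w i| <= \sum_(i : I) d.
Proof.
move=> vw; rewrite -sumrB (le_trans (ler_norm_sum _ _ _))//.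
apply: ler_sum => i _; rewrite -mulrBr normrM (le_trans _ (vw i))//.
rewrite ler_piMl// /half_sign; case: ifP => _; rewrite ?normrN ger0_norm; lra.
Qed.

End HalfSign.

Section Separation.
Context (R : realFieldType) (eps d W A B Z : R).
Hypothesis eps_lt : eps < 1 / 2.

(** Here [W] is the total mass of the rescaled state, [A] its accepted part, [B] the margin of the
    trigonometric part and [Z] its smooth approximation. Acceptance makes [A - W / 2] nonnegative,
    and [Z] is within [2 * d] of it. *)
Lemma accepted_bound : 0 < W -> (1 - eps) * W <= A ->
  `|A - 1 / 2 * W - B| <= d -> `|B - Z| <= d -> - Z <= 2 * d.
Proof.
move=> W0 AW; rewrite !ler_norml => /andP[? ?] /andP[? ?].
have : 0 <= (1 / 2 - eps) * W by rewrite mulr_ge0 ?(ltW W0)// subr_ge0 ltW.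
lra.
Qed.

(** Rejection gives [A - W / 2 <= - (1 / 2 - eps) * W], where [W >= D - d >= E - d]; the
    approximation errors fit in [4 * d]. *)
Lemma rejected_bound (D E : R) : 0 < eps -> 0 < d -> A <= eps * W ->
  `|A - 1 / 2 * W - B| <= d -> `|B - Z| <= d -> D - W <= d -> E <= D ->
  Z + (1 / 2 - eps) * E <= 4 * d.
Proof.
move=> eps0 d0 AW; rewrite !ler_norml => /andP[? ?] /andP[? ?] DW ED.
have : (1 / 2 - eps) * E <= (1 / 2 - eps) * (W + d).
  by apply: ler_wpM2l; [rewrite subr_ge0 ltW | lra].
have : (1 / 2 - eps) * d <= d by rewrite ler_piMl ?(ltW d0)//; lra.
lra.
Qed.

End Separation.

(** * Conflicting bounds on the mean of the margin *)

Theorem proposition13 (R : realType) (L : language unit)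
  (dens0 : lower_dens R L = 0%E)
  (unif : forall Q : nat, (0 < Q)%N ->
     exists (h : nat) (n_ : nat -> nat),
       (forall i : nat, L (apow (h + n_ i * Q)%N)) /\
       (forall alpha : R, irrational alpha ->
          unif_distr_mod1 (fun i : nat => (h + n_ i * Q)%:R * alpha))) :
  ~ BAfL R L.
Proof.
move=> [A [eps [eps0 eps_lt inL notinL]]].
have [th [G [Y [N1 [Guniq Gpos YT uE]]]]] := orbit_growth (afa_mx A tt) (afa_init A).
pose T := zspan th.
have T0 : T 0 := zspan0 th.
have TB (x y : R) : T x -> T y -> T (x - y) by exact: zspanB.
have [Q Q0 TQ] := zspan_torsion th.
have [h [n_ [nL nU]]] := unif Q Q0.
pose s1 i := (h + n_ i * Q)%N; pose s2 i := (h + i * Q)%N.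
have smp1 : @sampling R Q h s1.
  split=> [i|alpha irr]; first by exists (n_ i).
  by apply: eq_is_cmean (unif_distr_expi (nU _ irr)) => i; rewrite mulrC.
have smp2 : @sampling R Q h s2.
  by split=> [i|alpha irr]; [exists i | exact: mean_expi_progression].
pose k := afa_size A; pose acc := afa_acc A.
pose u n (i : 'I_k) := afa_final A (apow n) i 0.
have u_sum n : \sum_i u n i = 1.
  rewrite /u afa_final_apow; elim: n => [|n IH]; first exact: afa_init_affine.
  by apply: affine_vec_mul => //; exact: afa_mx_affine.
(* Coordinates summing to 1 cannot all vanish; this provides the leading growth. *)
have u_neq0 n : exists i, u n i != 0.
  apply: contrapT => none; have := u_sum n.
  rewrite big1 => [/esym/eqP|i _]; first by rewrite oner_eq0.
  by apply: contrapT => /eqP ui; apply: none; exists i.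
have [g0 [i0 [m0 y_neq0]] lead] : exists2 g0, (exists i m, Y g0 i (h + m * Q)%N != 0) &
    forall i d, 0 < d -> \forall n \near \oo, 0 < grow g0 n /\
      forall m, n = (h + m * Q)%N -> `|u n i / grow g0 n - Y g0 i n| <= d.
  apply: (@leading_part _ _ G Y u N1 h Q) => //.
    by move=> g i; have [B _ YB] := rtpoly_bounded (YT g i); exists B.
  by move=> n i /uE <-; rewrite /u afa_final_apow.
pose y := Y g0; have yT i : rtpoly T (y i) := YT g0 i.
have [B B0 yB] : exists2 B, 0 < B & forall i n, `|y i n| <= B.
  have /choice[b bP] (i : 'I_k) : exists b, 0 <= b /\ forall n, `|y i n| <= b.
    by have [b b0 yb] := rtpoly_bounded (yT i); exists b; split=> //; exact: ltW.
  exists (1 + \sum_i b i) => [|i n].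
    by rewrite ltr_pwDl// sumr_ge0// => i _; case: (bP i).
  rewrite (bigD1 i)//= ler_wpDl// (le_trans ((bP i).2 n))// lerDl sumr_ge0// => j _.
  by case: (bP j).
pose D n := \sum_i `|y i n|.
(* [D] involves absolute values; [E] is a trigonometric polynomial below it, because
   [y^2 <= B |y|]. *)
pose E n := B^-1 * \sum_i y i n ^+ 2.
have ET : rtpoly T E.
  apply: rtpolyZ => //; apply: rtpoly_sum => // i _.
  by apply: eq_tpoly (rtpolyM T0 TB (yT i) (yT i)) => n; rewrite expr2.
have ED n : E n <= D n.
  rewrite /E mulrC ler_pdivrMr// mulr_suml; apply: ler_sum => i _.
  by rewrite -real_normK ?num_real// expr2 ler_wpM2l.
have [lE lEm] := rtpoly_mean h TQ ET.
have lE0 : 0 < lE.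
  have sqT : rtpoly T (fun n => y i0 n ^+ 2).
    by apply: eq_tpoly (rtpolyM T0 TB (yT i0) (yT i0)) => n; rewrite expr2.
  have [l lm] := rtpoly_mean h TQ sqT.
  have l0 : 0 < l.
    have := rtpoly_mean_sq_gt0 TB TQ (yT i0) smp2 (lm _ smp2).
    by apply; exists m0.
  have : 0 <= lE - B^-1 * l.
    apply: is_mean_ge0 (is_meanB (lEm _ smp2) (is_meanZ (c := B^-1) (lm _ smp2))) => i.
    rewrite subr_ge0 ler_wpM2l ?invr_ge0 ?(ltW B0)// (bigD1 i0)//= lerDl.
    by apply: sumr_ge0 => j _; exact: sqr_ge0.
  have : 0 < B^-1 * l by rewrite mulr_gt0 ?invr_gt0.
  lra.
pose c := 1 / 2 - eps; have c0 : 0 < c by rewrite subr_gt0.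
(* The final bounds [- lZ <= 2 * d] and [lZ + c * lE <= 4 * d] add up to [c * lE <= 6 * d],
   impossible for this [d]. *)
pose d := c * lE / 8; have d0 : 0 < d by rewrite divr_gt0// mulr_gt0.
pose d' := d / k.+1%:R; have d'0 : 0 < d' by rewrite divr_gt0.
have kd' : \sum_(i < k) d' <= d.
  rewrite sumr_const card_ord -mulr_natr /d' -mulrA ler_piMr ?(ltW d0)//.
  by rewrite mulrC ler_pdivrMr// mul1r ler_nat.
have /choice[z zP] (i : 'I_k) : exists z, rtpoly T z /\ forall n, `| `|y i n| - z n| <= d'.
  by have [z zT zE] := rtpoly_abs T0 TB (yT i) d'0; exists z.
pose kap := half_sign R acc.
have kap_close (v w : 'I_k -> R) : (forall i, `|v i - w i| <= d') ->
    `|\sum_i kap i * v i - \sum_i kap i * w i| <= d.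
  by move=> vw; apply: le_trans kd'; exact: half_sign_close.
pose Z n := \sum_i kap i * z i n.
have ZT : rtpoly T Z.
  by apply: rtpoly_sum => // i _; apply: rtpolyZ => //; exact: (zP i).1.
(* The same [lZ] is the mean of [Z] along [s1] and along [s2]. *)
have [lZ lZm] := rtpoly_mean h TQ ZT.
have [BZ BZ0 ZB] := rtpoly_bounded ZT.
have [BE BE0 EB] := rtpoly_bounded ET.
have [n0 near_n0] : exists n0, forall n m, (n0 <= n)%N -> n = (h + m * Q)%N ->
    0 < grow g0 n /\ forall i, `|u n i / grow g0 n - y i n| <= d'.
  have : \forall n \near \oo, forall i, 0 < grow g0 n /\
      forall m, n = (h + m * Q)%N -> `|u n i / grow g0 n - Y g0 i n| <= d'.
    by apply: filter_forall => i; exact: lead.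
  move=> [n0 _ n0P]; exists n0 => n m n0n nE; split; first by have [] := n0P n n0n i0.
  by move=> i; have [_ /(_ m nE)] := n0P n n0n i.
have sepE n m : (n0 <= n)%N -> n = (h + m * Q)%N ->
    (L (apow n) -> - Z n <= 2 * d) /\ (~ L (apow n) -> Z n + c * E n <= 4 * d).
  move=> n0n nE; have [r0 close] := near_n0 n m n0n nE.
  set r := grow g0 n in r0 close.
  pose w i := `|u n i / r|.
  have wy i : `|w i - `|y i n| | <= d' by rewrite (le_trans (ler_dist_dist _ _))// close.
  have wE i : w i = `|u n i| / r by rewrite /w normrM normfV [`|r|]gtr0_norm.
  pose Dw := \sum_i w i.
  have Dw0 : 0 < Dw.
    rewrite /Dw; under eq_bigr do rewrite wE.
    rewrite -mulr_suml divr_gt0// (lt_le_trans (ltr01 : 0 < 1 :> R))//.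
    by rewrite -(u_sum n); apply: ler_sum => i _; exact: ler_norm.
  (* The acceptance ratio is unchanged when the state is divided by [r > 0]. *)
  have fE : afa_fun A (apow n) = (\sum_(i in acc) w i) / Dw.
    rewrite /afa_fun /Dw; under [in RHS]eq_bigr do rewrite wE.
    under [X in _ = _ / X]eq_bigr do rewrite wE.
    by rewrite -!mulr_suml -mulf_div divff ?mulr1// gt_eqF// invr_gt0.
  have h1 := kap_close _ _ wy.
  have h2 := kap_close _ _ (fun i => (zP i).2 n).
  rewrite half_sign_sum -/Dw in h1.
  have h3 : D n - Dw <= d.
    rewrite /D /Dw -sumrB (le_trans _ kd')//; apply: ler_sum => i _.
    by rewrite (le_trans (ler_norm _))// distrC.
  split=> [/inL|/notinL]; rewrite fE.
    rewrite ler_pdivlMr// => le1.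
    exact: accepted_bound eps_lt Dw0 le1 h1 h2.
  rewrite ler_pdivrMr// => le1.
  have := rejected_bound eps_lt eps0 d0 le1 h1 h2 h3 (ED n).
  exact.
have lZ_ge : - lZ <= 2 * d.
  apply: (@is_mean_le _ (fun i => - Z (s1 i)) _ _ BZ).
  - by move=> i; rewrite (le_trans (ler_norm _))// normrN.
  - have := is_meanZ (c := -1) (lZm _ smp1); rewrite mulN1r; apply: eq_is_mean => i.
    by rewrite mulN1r.
  move=> e N0 e0.
  (* The sequence [n_] may repeat values; equidistribution for the irrational [pi] makes the indices
     with [s1 i < n0] rare. *)
  have near_small := unif_distr_small_values n0 (nU _ pi_irrationnal) e0.
  near \oo => N; exists N; first by near: N; exact: nbhs_infty_ge.
  apply: le_trans (_ : (\sum_(i < N) (s1 i < n0)%N)%:R <= _); last by near: N.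
  rewrite ler_nat; apply: leq_sum => i _; case: (ltnP (s1 i) n0) => [_|le]; first exact: leq_b1.
  by rewrite ltNge (proj1 (sepE _ (n_ i) le erefl) (nL i)).
have lZE_le : lZ + c * lE <= 4 * d.
  apply: (@is_mean_le _ (fun i => Z (s2 i) + c * E (s2 i)) _ _ (BZ + c * BE)).
  - move=> i; apply: lerD; first exact: le_trans (ler_norm _) (ZB _).
    by apply: ler_wpM2l; [exact: ltW | exact: le_trans (ler_norm _) (EB _)].
  - exact: is_meanD (lZm _ smp2) (is_meanZ (lEm _ smp2)).
  move=> e N0 e0; have e20 : 0 < e / 2 by rewrite divr_gt0.
  (* Half of [e] pays for the words of [L] in the class, the other half for the first [n0] indices
     once [N] exceeds [n0 / (e / 2)]. *)
  have [N NN0 cnt] := progression_frequently h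
    (maxn N0 (Num.truncn (n0%:R / (e / 2))).+1) dens0 Q0 e20.
  move: NN0; rewrite geq_max => /andP[NN0 Nbig]; exists N => //.
  apply: le_trans (_ : (n0 + \sum_(i < N) (apow (s2 i) \in L))%:R <= _).
    rewrite ler_nat.
    apply: (@leq_trans (\sum_(i < N) ((i < n0) + (apow (s2 i) \in L)))%N).
      apply: leq_sum => i _; case: (boolP (apow (s2 i) \in L)) => [_|nLi].
        by rewrite (leq_trans (leq_b1 _))// leq_addl.
      case: (ltnP i n0) => [_|le]; first by rewrite (leq_trans (leq_b1 _)).
      have le' : (n0 <= s2 i)%N by rewrite (leq_trans le)// (leq_trans (leq_pmulr _ Q0))// leq_addl.
      rewrite ltNge (proj2 (sepE _ i le' erefl))//.
      by move=> Li; move: nLi; rewrite mem_set.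
    by rewrite big_split /= leq_add2r sum_ltn_const geq_minr.
  have : n0%:R <= e / 2 * N%:R.
    rewrite mulrC -ler_pdivrMr// ltW// (lt_le_trans (truncnS_gt _))//.
    by rewrite ler_nat.
  by move=> ?; rewrite natrD [e]splitr mulrDl lerD.
have cl0 : 0 < c * lE := mulr_gt0 c0 lE0.
have dE : d = c * lE / 8 by [].
by clear - lZ_ge lZE_le cl0 dE; lra.
Unshelve. all: by end_near. Qed.
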